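(* Let $(M,\omega)$ be a $4$-dimensional symplectic manifold with compatible almost complex structure $J$, let $\bar o\subset M$ be a Lagrangian (singly) pinched torus with pinch point $p_0$, and let $\mu_+,\mu_-$ be the Maslov indices of the loops $\lambda_+,\lambda_-$ on $\bar o$ near $p_0$. Then the bundle $\Gamma_J^2|_{\bar o}$ is isomorphic to $\bar o\times S^1$ if and only if $\mu_+=\mu_-$.
   Context: Maslov bundle (here $n=2$): $J$ is compatible if $g_J(u,v)=\omega(Ju,v)$ is a Riemannian metric. A unitary frame is a basis $(u_1,\dots,u_n,v_1,\dots,v_n)$ of $T_pM$ with $v_i=-Ju_i$, $g_J(u_i,u_j)=\delta_{ij}$, $g_J(u_i,v_j)=0$. $\mathbb{U}(n)$ is identified with the real matrices $C=\begin{bmatrix} A & -B \\ B & A \end{bmatrix}$, $A+iB$ unitary, acting on frames from the right; $\det_{\mathbb C}C=\det(A+iB)$; $\mathbb{O}(n)=\{B=0\}$; $\mathbb{EU}(n)=\{\det_{\mathbb C}=\pm1\}$. $Fr^u_J$ is the principal bundle of unitary frames, $\Lambda_J=Fr_J^u/\mathbb{O}(n)$ is identified with the bundle of Lagrangian planes via $[(u,v)]\mapsto\mathrm{span}\{u_1,\dots,u_n\}$, and $\Gamma_J^2=Fr^u_J/\mathbb{EU}(n)\to M$ is a principal $S^1$ bundle with inherent action $[f]\cdot z=[f\cdot C]$ for any $C$ with $(\det_{\mathbb C}C)^2=z$. $det_J^2:\Lambda_J\to\Gamma_J^2$ is the natural quotient map. Lagrangian pinched torus: it is represented by a continuous map $\mathfrak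 p:S^1\times[-1,1]\to M$ whose restriction to $S^1\times(-1,1)$ is a Lagrangian embedding and which factors through an embedding of $(S^1\times[-1,1])/(S^1\times\{\pm1\})$ (all of $S^1\times\{-1,1\}$ identified to one point) into $M$. Its image is $\bar o$, $\{p_0\}=\mathfrak p(S^1\times\{\pm1\})$, and $o=\bar o\setminus\{p_0\}$. Indices $\mu_\pm$: let $B$ be an open contractible neighbourhood of $p_0$ in $M$ and $a\in(0,1)$ such that $\mathfrak p(S^1\times[a,1])\cup\mathfrak p(S^1\times[-1,-a])\subset B$. Let $\lambda_\pm:S^1\to o$, $\lambda_\pm(z)=\mathfrak p(z,\pm a)$. Choose a section $\mathfrak s:B\to\Gamma_J^2|_B$, with trivialization $tr_{\mathfrak s}:\mathfrak s(q)\cdot z\mapsto(q,z)$. Then $\mu_\pm$ is the Maslov index of $\lambda_\pm$, i.e. the degree of $S^1\to S^1$, $z\mapsto pr_{S^1}\circ tr_{\mathfrak s}\circ det_J^2(T_{\lambda_\pm(z)}o)$; it does not depend on $\mathfrak s$. *)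

(* Defs.v *)
From HB Require Import structures.
From mathcomp Require Import all_boot all_order all_algebra.
From mathcomp Require Import generic_quotient.
From mathcomp Require Import complex.
From mathcomp Require Import all_classical all_reals all_analysis.
Set Implicit Arguments.
Unset Strict Implicit.
Unset Printing Implicit Defensive.
Import Order.TTheory GRing.Theory Num.Theory.
Import numFieldNormedType.Exports.
Local Open Scope classical_set_scope.
Local Open Scope ring_scope.
Local Open Scope complex_scope.
Local Open Scope quotient_scope.

Definition embedding (X Y : topologicalType) (f : X -> Y) : Prop :=
  [/\ continuous f, injective f &
      forall U : set X, open U -> exists2 V : set Y, open V & f @^-1` V = U].

Definition contractible (R : realType) (X : topologicalType) (B : set X) :
    Prop :=
  exists c : X, exists H : R * X -> X,
    [/\ B c, {within `[0, 1]%classic `*` B, continuous H},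
        forall t q, 0 <= t <= 1 -> B q -> B (H (t, q)),
        forall q, B q -> H (0, q) = q &
        forall q, B q -> H (1, q) = c].

(** * The circle *)

Definition circle (R : realType) := {z : R[i] | `|z| == 1}.

HB.instance Definition _ (R : realType) := Choice.on (circle R).
HB.instance Definition _ (R : realType) := Topological.copy (circle R)
  (initial_topology (fun z : circle R =>
     (complex.Re (val z), complex.Im (val z)) : R * R)).

Lemma circle_mul_subproof (R : realType) (z w : circle R) :
  `|val z * val w| == 1.
Proof. by rewrite normrM (eqP (valP z)) (eqP (valP w)) mulr1. Qed.

Definition circle_mul (R : realType) (z w : circle R) : circle R :=
  exist (fun u : R[i] => `|u| == 1) _ (circle_mul_subproof z w).

Lemma expi_subproof (R : realType) (t : R) : `|cos t +i* sin t| == 1.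
Proof. by rewrite normc_def /= cos2Dsin2 sqrtr1. Qed.

Definition expi (R : realType) (t : R) : circle R :=
  exist (fun u : R[i] => `|u| == 1) _ (expi_subproof t).

Definition is_degree (R : realType) (f : circle R -> circle R) (d : int) :
    Prop :=
  exists theta : R -> R,
    [/\ continuous theta, forall t, f (expi t) = expi (theta t) &
        theta (2 * pi) = theta 0 + 2 * pi * d%:~R].

(* The value 0 is only taken by convention when f has no continuous lift,
   i.e. when f is not continuous. *)
Definition degree (R : realType) (f : circle R -> circle R) : int :=
  xget 0 [set d | is_degree f d].

(** * Smooth manifolds and tangent vectors *)

(* For an open set A. *)
Fixpoint Ck_on (R : realType) (m : nat) (W : normedModType R) (k : nat)
    (A : set 'rV[R]_m) (f : 'rV[R]_m -> W) : Prop :=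
  if k is k'.+1 then
    (forall x, A x -> differentiable f x) /\
    (forall v : 'rV[R]_m, Ck_on k' A (fun x => 'D_v f x))
  else forall x, A x -> {for x, continuous f}.

Definition smooth_on (R : realType) (m : nat) (W : normedModType R)
    (A : set 'rV[R]_m) (f : 'rV[R]_m -> W) : Prop :=
  forall k, Ck_on k A f.

(* Any smooth atlas is allowed, not only maximal ones. The preferred chart
   [chart_at p] at p is only used to have a concrete model of T_pM. *)
Record smooth_manifold (R : realType) (m : nat) := SmoothManifold {
  manifold_sort :> topologicalType;
  chart_ix : Type;
  dom : chart_ix -> set manifold_sort;
  chart : chart_ix -> manifold_sort -> 'rV[R]_m;
  chart_inv : chart_ix -> 'rV[R]_m -> manifold_sort;
  chart_at : manifold_sort -> chart_ix;
  manifold_hausdorff : hausdorff_space manifold_sort;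
  manifold_second_countable : @second_countable manifold_sort;
  dom_open : forall i, open (dom i);
  chart_open : forall i, open (chart i @` dom i);
  chartK : forall i p, dom i p -> chart_inv i (chart i p) = p;
  chart_continuous : forall i, {within dom i, continuous (chart i)};
  chart_inv_continuous :
    forall i, {within chart i @` dom i, continuous (chart_inv i)};
  chart_atP : forall p, dom (chart_at p) p;
  chart_smooth : forall i j,
    smooth_on (chart i @` (dom i `&` dom j)) (chart j \o chart_inv i)
}.
Arguments dom {R m M} : rename.
Arguments chart {R m M} : rename.
Arguments chart_inv {R m M} : rename.
Arguments chart_at {R m M} : rename.

(* The tangent space T_pM is 'rV[R]_m, a vector being given by its coordinates
   in the chart [chart_at p]. Vectors are rows, so that linear maps act by
   multiplication on the right. If v is the coordinate row of a tangent vector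
   at p in the chart i, then v *m change i j p is its coordinate row in the
   chart j. In particular row a of [change i (chart_at p) p] is the a-th
   coordinate vector of the chart i, as an element of T_pM. *)
Definition change (R : realType) (m : nat) (M : smooth_manifold R m)
    (i j : chart_ix M) (p : M) : 'M[R]_m :=
  jacobian (chart j \o chart_inv i) (chart i p).

(* Coordinate expression, in the chart i, of a field Om of bilinear forms
   (u, v) |-> u *m Om p *m v^T on the spaces T_pM. *)
Definition form_in (R : realType) (m : nat) (M : smooth_manifold R m)
    (Om : M -> 'M[R]_m) (i : chart_ix M) (x : 'rV[R]_m) : 'M[R]_m :=
  let p := chart_inv i x in
  change i (chart_at p) p *m Om p *m (change i (chart_at p) p)^T.

(* Coordinate expression, in the chart i, of a field J of endomorphisms
   u |-> u *m J p of the spaces T_pM. *)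
Definition endo_in (R : realType) (m : nat) (M : smooth_manifold R m)
    (J : M -> 'M[R]_m) (i : chart_ix M) (x : 'rV[R]_m) : 'M[R]_m :=
  let p := chart_inv i x in
  change i (chart_at p) p *m J p *m change (chart_at p) i p.

Definition partial (R : realType) (m : nat) (a : 'I_m) (h : 'rV[R]_m -> R)
    (x : 'rV[R]_m) : R :=
  'D_(delta_mx 0 a) h x.

Record symplectic_form (R : realType) (m : nat) (M : smooth_manifold R m) :=
  SymplecticForm {
  omega :> M -> 'M[R]_m;
  omega_skew : forall p, (omega p)^T = - omega p;
  omega_nondegenerate : forall p (u : 'rV[R]_m),
    (forall v : 'rV[R]_m, u *m omega p *m v^T = 0) -> u = 0;
  omega_smooth : forall i : chart_ix M,
    smooth_on (chart i @` dom i) (form_in omega i);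
  omega_closed : forall (i : chart_ix M) (a b c : 'I_m) x,
    (chart i @` dom i) x ->
    partial a (fun y => form_in omega i y b c) x +
    partial b (fun y => form_in omega i y c a) x +
    partial c (fun y => form_in omega i y a b) x = 0
}.

(* The matrix of g_J(u, v) = omega(J u, v). *)
Definition gJ (R : realType) (m : nat) (M : smooth_manifold R m)
    (om J : M -> 'M[R]_m) (p : M) : 'M[R]_m := J p *m om p.

Record compatible_structure (R : realType) (m : nat) (M : smooth_manifold R m)
    (om : symplectic_form M) := CompatibleStructure {
  acs :> M -> 'M[R]_m;
  acs_smooth : forall i : chart_ix M,
    smooth_on (chart i @` dom i) (endo_in acs i);
  acs_sqr : forall p, acs p *m acs p = - 1%:M;
  acs_sym : forall p, (gJ om acs p)^T = gJ om acs p;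
  acs_pos : forall p (u : 'rV[R]_m),
    u != 0 -> 0 < (u *m gJ om acs p *m u^T) 0 0
}.

(** * The unitary group as a group of real matrices *)

Definition complex_mx (R : realType) (n : nat) (A B : 'M[R]_n) : 'M[R[i]]_n :=
  \matrix_(k, l) (A k l +i* B k l).

Definition unitary_real (R : realType) (n : nat) (C : 'M[R]_(n + n)) : Prop :=
  exists A B : 'M[R]_n,
    C = block_mx A (- B) B A /\ complex_mx A B \is unitarymx.

Definition detC (R : realType) (n : nat) (C : 'M[R]_(n + n)) : R[i] :=
  \det (complex_mx (ulsubmx C) (dlsubmx C)).

Definition eunitary_real (R : realType) (n : nat) (C : 'M[R]_(n + n)) : Prop :=
  unitary_real C /\ (detC C = 1 \/ detC C = - 1).

(** * Unitary frames *)

(* The rows of F are the vectors u_1, ..., u_n, v_1, ..., v_n of T_pM. *)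
Definition is_unitary_frame (R : realType) (n : nat)
    (M : smooth_manifold R (n + n)) (om : symplectic_form M)
    (J : compatible_structure om) (p : M) (F : 'M[R]_(n + n)) : Prop :=
  let u := usubmx F in let v := dsubmx F in
  [/\ F \in unitmx, v = - (u *m J p),
      u *m gJ om J p *m u^T = 1%:M & u *m gJ om J p *m v^T = 0].

Definition frame (R : realType) (n : nat)
    (M : smooth_manifold R (n + n)) (om : symplectic_form M)
    (J : compatible_structure om) :=
  {x : M * 'M[R]_(n + n) | `[< is_unitary_frame J x.1 x.2 >]}.

HB.instance Definition _ (R : realType) (n : nat)
    (M : smooth_manifold R (n + n)) (om : symplectic_form M)
    (J : compatible_structure om) := Choice.on (frame J).

Section Frames.
Context (R : realType) (n : nat) (M : smooth_manifold R (n + n)).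
Context (om : symplectic_form M) (J : compatible_structure om).
Implicit Types (f h : frame J) (p q : M).

Definition fbase f : M := (val f).1.
Definition fmat f : 'M[R]_(n + n) := (val f).2.

(* Local trivialization, over dom i, of the bundle of (n + n)-tuples of tangent
   vectors: base point and coordinate rows in the chart i. *)
Definition frame_coord (i : chart_ix M) f : M * 'M[R]_(n + n) :=
  (fbase f, fmat f *m change (chart_at (fbase f)) i (fbase f)).

(* The topology making all the [frame_coord i] topological embeddings on the
   open sets of frames over dom i. It is not the topology induced by
   M * 'M[R]_(n + n), as [chart_at] need not be continuous in any sense. *)
Definition frame_open (A : set (frame J)) : Prop :=
  forall i : chart_ix M, exists2 W : set (M * 'M[R]_(n + n)), open W &
    forall f, dom i (fbase f) -> (A f <-> W (frame_coord i f)).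

Lemma frame_openT : frame_open setT.
Proof. by move=> i; exists setT => //; exact: openT. Qed.

Lemma frame_openI : setI_closed frame_open.
Proof.
move=> A B oA oB i; have [V oV AV] := oA i; have [W oW BW] := oB i.
exists (V `&` W); first exact: openI.
by move=> f df; split=> -[/(AV _ df) ? /(BW _ df) ?].
Qed.

Lemma frame_open_bigcup (I : Type) (A : I -> set (frame J)) :
  (forall k, frame_open (A k)) -> frame_open (\bigcup_k A k).
Proof.
move=> oA i; have /choice[W WP] k : exists W : set (M * 'M[R]_(n + n)),
    open W /\ forall f, dom i (fbase f) -> (A k f <-> W (frame_coord i f)).
  by have [W oW AW] := oA k i; exists W.
exists (\bigcup_k W k); first by apply: bigcup_open => k _; case: (WP k).
move=> f df; split=> -[k _ Hk]; exists k => //.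
  by case: (WP k) => _ /(_ f df) <-.
by case: (WP k) => _ /(_ f df) ->.
Qed.

End Frames.

HB.instance Definition _ (R : realType) (n : nat)
    (M : smooth_manifold R (n + n)) (om : symplectic_form M)
    (J : compatible_structure om) :=
  isOpenTopological.Build (frame J) (@frame_openT R n M om J)
    (@frame_openI R n M om J) (@frame_open_bigcup R n M om J).

(* h = f . C, i.e. h_j = \sum_i f_i C_ij; the vectors of a frame being the rows
   of its matrix, this reads fmat h = C^T *m fmat f. *)
Definition frame_act (R : realType) (n : nat)
    (M : smooth_manifold R (n + n)) (om : symplectic_form M)
    (J : compatible_structure om) (f h : frame J) (C : 'M[R]_(n + n)) : Prop :=
  fbase h = fbase f /\ fmat h = C^T *m fmat f.

(** * The circle bundle Gamma_J^2 = Fr^u_J / EU(n) *)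

Definition EU_orbit (R : realType) (n : nat)
    (M : smooth_manifold R (n + n)) (om : symplectic_form M)
    (J : compatible_structure om) (f : frame J) : set (frame J) :=
  [set h | exists2 C, eunitary_real C & frame_act f h C].

Definition Gamma (R : realType) (n : nat)
    (M : smooth_manifold R (n + n)) (om : symplectic_form M)
    (J : compatible_structure om) :=
  {S : set (frame J) | `[< exists f, S = EU_orbit f >]}.

HB.instance Definition _ (R : realType) (n : nat)
    (M : smooth_manifold R (n + n)) (om : symplectic_form M)
    (J : compatible_structure om) := Choice.on (Gamma J).

Section GammaBundle.
Context (R : realType) (n : nat) (M : smooth_manifold R (n + n)).
Context (om : symplectic_form M) (J : compatible_structure om).
Implicit Types (f h : frame J) (x y : Gamma J).

Definition gclass f : Gamma J :=
  exist _ (EU_orbit f) (asboolT (ex_intro _ f erefl)).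

Definition gbase x : M := fbase (projT1 (cid (asboolW (valP x)))).

(* Quotient topology. *)
Definition Gamma_open (A : set (Gamma J)) : Prop := open (gclass @^-1` A).

Lemma Gamma_openT : Gamma_open setT.
Proof. by rewrite /Gamma_open preimage_setT; exact: openT. Qed.

Lemma Gamma_openI : setI_closed Gamma_open.
Proof. by move=> A B; exact: openI. Qed.

Lemma Gamma_open_bigcup (I : Type) (A : I -> set (Gamma J)) :
  (forall k, Gamma_open (A k)) -> Gamma_open (\bigcup_k A k).
Proof. by move=> oA; apply: bigcup_open => k _; exact: oA. Qed.

End GammaBundle.

HB.instance Definition _ (R : realType) (n : nat)
    (M : smooth_manifold R (n + n)) (om : symplectic_form M)
    (J : compatible_structure om) :=
  isOpenTopological.Build (Gamma J) (@Gamma_openT R n M om J)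
    (@Gamma_openI R n M om J) (@Gamma_open_bigcup R n M om J).

Section CircleAction.
Context (R : realType) (n : nat) (M : smooth_manifold R (n + n)).
Context (om : symplectic_form M) (J : compatible_structure om).

(* [f] . z = [f . C] for any C with (det_C C)^2 = z. *)
Definition gact (x : Gamma J) (z : circle R) : Gamma J :=
  xget x [set y | exists f h : frame J, exists C : 'M[R]_(n + n),
    [/\ unitary_real C, detC C ^+ 2 = val z, frame_act f h C,
        x = gclass f & y = gclass h]].

(* Isomorphism, as principal circle bundles over Y, of the restriction of
   Gamma_J^2 to Y with Y * S^1. *)
Definition trivial_over (Y : set M) : Prop :=
  exists (Phi : M * circle R -> Gamma J) (Psi : Gamma J -> M * circle R),
  [/\ {within Y `*` setT, continuous Phi},
      {within [set x | Y (gbase x)], continuous Psi},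
      forall q z, Y q -> gbase (Phi (q, z)) = q /\ Psi (Phi (q, z)) = (q, z),
      forall x, Y (gbase x) -> (Psi x).1 = gbase x /\ Phi (Psi x) = x &
      forall q z w, Y q -> Phi (q, circle_mul z w) = gact (Phi (q, z)) w].

Definition section_over (B : set M) (s : M -> Gamma J) : Prop :=
  {within B, continuous s} /\ forall q, B q -> gbase (s q) = q.

Definition frame_span (f : frame J) : set 'rV[R]_(n + n) :=
  [set v | exists c : 'rV[R]_n, v = c *m usubmx (fmat f)].

(* det_J^2 at the Lagrangian plane L in T_pM, i.e. the EU(n)-orbit of any
   unitary frame (u, v) at p such that L is the span of u_1, ..., u_n. *)
Definition detJ2 (p : M) (L : set 'rV[R]_(n + n)) : set (frame J) :=
  [set h | exists f : frame J,
     [/\ fbase f = p, frame_span f = L & EU_orbit f h]].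

(* Circle component of the trivialization s(q) . z |-> (q, z), at the point X
   of the fibre over q. *)
Definition triv_coord (s : M -> Gamma J) (q : M) (X : set (frame J)) :
    circle R :=
  xget (expi 0) [set z | val (gact (s q) z) = X].

Definition maslov_index (s : M -> Gamma J) (lam : circle R -> M)
    (T : M -> set 'rV[R]_(n + n)) : int :=
  degree (fun z => triv_coord s (lam z) (detJ2 (lam z) (T (lam z)))).

End CircleAction.

(** * Lagrangian pinched tori *)

Definition open_cylinder (R : realType) : set (circle R * R) :=
  [set x | -1 < x.2 < 1].

Definition closed_cylinder (R : realType) : set (circle R * R) :=
  [set x | -1 <= x.2 <= 1].

Arguments open_cylinder : clear implicits.
Arguments closed_cylinder : clear implicits.

Definition pinch_rel (R : realType) (x y : closed_cylinder R) : bool :=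
  (x == y) || ((`|(val x).2| == 1) && (`|(val y).2| == 1)).

Lemma pinch_relP (R : realType) : equiv_class_of (@pinch_rel R).
Proof.
split=> [x|x y|y x z]; rewrite /pinch_rel ?eqxx//.
  by rewrite eq_sym andbC.
have [->//|_ /= /andP[-> ey]] := eqVneq x y.
have [<-//=|_ /= /andP[_ ->]] := eqVneq y z; first by rewrite ey orbT.
by rewrite orbT.
Qed.

Canonical pinch_equiv (R : realType) := EquivRelPack (pinch_relP R).

Definition pinched_cylinder (R : realType) :=
  quotient_topology {eq_quot @pinch_equiv R}.

Section PinchedTorus.
Context (R : realType) (M : smooth_manifold R (2 + 2)).
Context (om : symplectic_form M).
Variable P : circle R * R -> M.

Definition polar (x : 'rV[R]_2) : circle R * R := (expi (x 0 0), x 0 1).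

(* The differential of P at polar x; its rows are the images in T_(P (polar x))M
   of the coordinate vectors d/dtheta and d/dt. *)
Definition dP (x : 'rV[R]_2) : 'M[R]_(2, 2 + 2) :=
  jacobian (chart (chart_at (P (polar x))) \o P \o polar) x.

(* The smooth structure of S^1 * ]-1, 1[ is the one for which [polar] is a
   local diffeomorphism. *)
Definition lagrangian_embedding : Prop :=
  [/\ forall i : chart_ix M,
        smooth_on [set x | open_cylinder R (polar x) /\ dom i (P (polar x))]
          (chart i \o P \o polar),
      forall x, open_cylinder R (polar x) -> \rank (dP x) = 2%N,
      embedding (fun x : open_cylinder R => P (val x)) &
      forall x, open_cylinder R (polar x) ->
        dP x *m om (P (polar x)) *m (dP x)^T = 0].

Definition lagrangian_pinched_torus : Prop :=
  [/\ {within closed_cylinder R, continuous P}, lagrangian_embedding &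
      exists2 e : pinched_cylinder R -> M, embedding e &
        forall x : closed_cylinder R,
          P (val x) = e (\pi_(pinched_cylinder R) x)].

Definition obar : set M := P @` closed_cylinder R.

Definition is_pinch_point (p0 : M) : Prop :=
  P @` [set x | x.2 = 1 \/ x.2 = -1] = [set p0].

(* T_q o, for q in o = P (S^1 * ]-1, 1[). *)
Definition tangent_o (q : M) : set 'rV[R]_(2 + 2) :=
  [set v | exists x, exists c : 'rV[R]_2,
     [/\ open_cylinder R (polar x), P (polar x) = q & v = c *m dP x]].

End PinchedTorus.

(* Main.v *)
(* [trivial_over] amounts to the existence of a global section.  The Lagrangian
   torus provides a section [sigma] of Gamma_J^2 over the open cylinder, and on
   the two collars around the pinch point sigma = s . g for a circle-valued g
   whose degrees on the boundary circles of the collars are the Maslov indices.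
   If tau is a section over obar, then sigma = tau . k with k defined on the
   whole open cylinder, so that k has the same degree on both circles, and
   s = tau . l with l constant at the pinch point, so that l has degree 0;
   hence g = k / l has the same degree on both circles.  Conversely, if these
   degrees agree, the quotient of the two restrictions of g lifts to a real
   function, along which g can be interpolated over the middle of the cylinder,
   and sigma . g^-1 extends s to a section over obar. *)
Require Import Defs.
From HB Require Import structures.
From mathcomp Require Import all_boot all_order all_algebra.
From mathcomp Require Import generic_quotient complex zify ring lra.
From mathcomp Require Import all_classical all_reals all_analysis.
Set Implicit Arguments.
Unset Strict Implicit.
Unset Printing Implicit Defensive.
Import Order.TTheory GRing.Theory Num.Theory.
Import numFieldNormedType.Exports.
Local Open Scope classical_set_scope.
Local Open Scope ring_scope.

(** * Circle-valued maps *)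

(** Degrees enter only through the relation [csim]: two circle-valued maps on the circle have the
    same degree exactly when their quotient is [expi] of a continuous real function. In this form
    homotopies, constant factors and interpolations all become real functions that add up, and no
    winding number has to be computed. The topological obstacle is that frames are written in charts
    [chart_at] chosen without any continuity, while the circle bundle carries a quotient topology.
    Sections are therefore compared by their quotient [gdiv]. It is continuous because the
    projection from frames is open and because the quotient of two frames over one point is the
    squared determinant of a transition matrix, from which the charts cancel. In the converse, the
    middle band and the collars are closed and meet only in the circles at heights [a] and [- a], so
    agreement there is enough for gluing; the boundary circles see only [s], hence the glued section
    passes to the pinched quotient. *)

Section Circle.
Context {R : realType}.
Implicit Types (z w : circle R) (t : R).

Definition cre z : R := complex.Re (val z).
Definition cim z : R := complex.Im (val z).

Lemma circle_eqP z w : cre z = cre w -> cim z = cim w -> z = w.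
Proof.
move=> er ei; apply/val_inj; move: er ei; rewrite /cre /cim.
by case: (val z) => a b; case: (val w) => c d /= -> ->.
Qed.

Lemma cre2Dcim2 z : cre z ^+ 2 + cim z ^+ 2 = 1.
Proof.
have /eqP := valP z; rewrite /cre /cim; case: (val z) => a b /=.
rewrite normc_def /= => /(congr1 (@complex.Re R))/= /(congr1 (fun x => x ^+ 2)).
by rewrite sqr_sqrtr ?expr1n// addr_ge0 ?sqr_ge0.
Qed.

Lemma cre_mul z w : cre (circle_mul z w) = cre z * cre w - cim z * cim w.
Proof. by rewrite /cre /cim /=; case: (val z) => a b; case: (val w) => c d. Qed.

Lemma cim_mul z w : cim (circle_mul z w) = cre z * cim w + cim z * cre w.
Proof. by rewrite /cre /cim /=; case: (val z) => a b; case: (val w) => c d. Qed.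

Lemma cinv_subproof z : `|Complex (cre z) (- cim z)| == 1.
Proof. by rewrite normc_def /= sqrrN cre2Dcim2 sqrtr1. Qed.

Definition cinv z : circle R :=
  exist (fun u : R[i] => `|u| == 1) _ (cinv_subproof z).

Lemma cre_inv z : cre (cinv z) = cre z. Proof. by []. Qed.
Lemma cim_inv z : cim (cinv z) = - cim z. Proof. by []. Qed.
Lemma cre_expi t : cre (expi t) = cos t. Proof. by []. Qed.
Lemma cim_expi t : cim (expi t) = sin t. Proof. by []. Qed.

Lemma cmulC : commutative (@circle_mul R).
Proof. by move=> z w; apply/val_inj; rewrite /= mulrC. Qed.

Lemma cmulA : associative (@circle_mul R).
Proof. by move=> z w u; apply/val_inj; rewrite /= mulrA. Qed.

Lemma cmul1 z : circle_mul z (expi 0) = z.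
Proof.
by apply: circle_eqP; rewrite ?cre_mul ?cim_mul cre_expi cim_expi cos0 sin0; ring.
Qed.

Lemma cmulV z : circle_mul z (cinv z) = expi 0.
Proof.
apply: circle_eqP; rewrite ?cre_mul ?cim_mul cre_inv cim_inv.
  by rewrite cre_expi cos0 -(cre2Dcim2 z); ring.
by rewrite cim_expi sin0; ring.
Qed.

Lemma cmulK z w : circle_mul (circle_mul z w) (cinv w) = z.
Proof. by rewrite -cmulA cmulV cmul1. Qed.

Lemma cmulVK z w : circle_mul (circle_mul z (cinv w)) w = z.
Proof. by rewrite -cmulA (cmulC (cinv w)) cmulV cmul1. Qed.

Lemma expiD t u : expi (t + u) = circle_mul (expi t) (expi u).
Proof.
apply: circle_eqP; rewrite ?cre_mul ?cim_mul !(cre_expi, cim_expi).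
  exact: cosD.
by rewrite sinD addrC.
Qed.

Lemma expiN t : expi (- t) = cinv (expi t).
Proof. by rewrite -[RHS]cmul1 -(subrr t) expiD cmulA (cmulC (cinv _)) cmulV cmulC cmul1. Qed.

Lemma cre_cvg (T : Type) (F : set_system T) (FF : Filter F) (f : T -> circle R) z :
  cre (f x) @[x --> F] --> cre z -> cim (f x) @[x --> F] --> cim z ->
  f @ F --> z.
Proof.
move=> cr ci U; rewrite nbhsE => -[V [[W oW <-] Wz] WU].
have nW : nbhs (cre z, cim z) W by apply: open_nbhs_nbhs; split.
have FW : F (fun x => W (cre (f x), cim (f x))) by exact: (cvg_pair cr ci nW).
by apply: (@filterS _ F _ _ _ _ FW) => x /WU.
Qed.

Lemma cpair_continuous : continuous (fun z => (cre z, cim z)).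
Proof.
exact: (@initial_continuous (circle R) _
  (fun z : circle R => (complex.Re (val z), complex.Im (val z)) : R * R)).
Qed.

Lemma cre_continuous : continuous cre.
Proof.
by move=> z; exact: (cvg_comp _ _ (@cpair_continuous z) cvg_fst).
Qed.

Lemma cim_continuous : continuous cim.
Proof.
by move=> z; exact: (cvg_comp _ _ (@cpair_continuous z) cvg_snd).
Qed.

Lemma circle_hausdorff : hausdorff_space (circle R).
Proof.
move=> z w zw; suff e : (cre z, cim z) = (cre w, cim w).
  by case: e => ? ?; exact: circle_eqP.
apply: (@norm_hausdorff R (R * R)%type) => A B nA nB.
have [u [Au Bu]] := zw _ _ (cpair_continuous nA) (cpair_continuous nB).
by exists (cre u, cim u).
Qed.

Section Filters.
Context {T : Type} {F : set_system T} {FF : Filter F}.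
Implicit Types (f g : T -> circle R).

Lemma cvg_cre f z : f @ F --> z -> cre (f x) @[x --> F] --> cre z.
Proof. by move=> fz; exact: (cvg_comp _ _ fz (@cre_continuous z)). Qed.

Lemma cvg_cim f z : f @ F --> z -> cim (f x) @[x --> F] --> cim z.
Proof. by move=> fz; exact: (cvg_comp _ _ fz (@cim_continuous z)). Qed.

Lemma cmul_cvg f g z w : f @ F --> z -> g @ F --> w ->
  circle_mul (f x) (g x) @[x --> F] --> circle_mul z w.
Proof.
move=> fz gw; have [fr fi] := (cvg_cre fz, cvg_cim fz).
have [gr gi] := (cvg_cre gw, cvg_cim gw).
apply: cre_cvg; rewrite ?cre_mul ?cim_mul.
  under eq_fun do rewrite cre_mul.
  by apply: cvgB; exact: cvgM.
under eq_fun do rewrite cim_mul.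
by apply: cvgD; exact: cvgM.
Qed.

Lemma cinv_cvg f z : f @ F --> z -> cinv (f x) @[x --> F] --> cinv z.
Proof.
move=> fz; apply: cre_cvg; first exact: (cvg_cre fz).
exact: cvgN (cvg_cim fz).
Qed.

Lemma expi_cvg (f : T -> R) t : f @ F --> t -> expi (f x) @[x --> F] --> expi t.
Proof.
move=> ft; apply: cre_cvg.
  exact: (cvg_comp _ _ ft (@continuous_cos R t)).
exact: (cvg_comp _ _ ft (@continuous_sin R t)).
Qed.

End Filters.

Lemma expi_continuous : continuous (@expi R).
Proof. by move=> t; apply: expi_cvg; exact: cvg_id. Qed.

(* The principal argument, by the half-angle formula; a junk value at z = -1. *)
Definition arg z : R := 2 * atan (cim z / (1 + cre z)).

(** With [u] the tangent of half the angle, this is the rational parametrization of the circle minus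
    -1, recovered from the double-angle formulas. *)
Lemma argK z : cre z != -1 -> expi (arg z) = z.
Proof.
move=> zN1; have z1 : 1 + cre z != 0 by rewrite addrC -[1]opprK subr_eq0.
rewrite /arg; set u := cim z / _.
have zu : cim z = u * (1 + cre z) by rewrite /u mulfVK.
have u1 : 1 + u ^+ 2 != 0 by rewrite lt0r_neq0// ltr_pwDl// sqr_ge0.
have ez : (1 + u ^+ 2) * cre z = 1 - u ^+ 2.
  (* Multiplied by [1 + cre z], the claim becomes the equation of the circle. *)
  apply/eqP; rewrite -subr_eq0 -(mulIr_eq0 _ (mulIf z1)); apply/eqP.
  transitivity (cre z ^+ 2 + (u * (1 + cre z)) ^+ 2 - 1); first by ring.
  by rewrite -zu cre2Dcim2 subrr.
have cr : cre z = (1 - u ^+ 2) / (1 + u ^+ 2).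
  by rewrite -ez mulrAC mulfV// mul1r.
have cosu : cos (atan u) ^+ 2 = (1 + u ^+ 2)^-1.
  by rewrite cos_atan exprVn sqr_sqrtr// addr_ge0// sqr_ge0.
have cn0 : cos (atan u) != 0.
  by rewrite -sqrf_eq0 cosu invr_eq0.
have sinu : sin (atan u) = u * cos (atan u).
  by rewrite -{2}(atanK u) /tan mulfVK.
rewrite mulr_natl; apply: circle_eqP.
  rewrite cre_expi cos_mulr2n cosu cr.
  by field.
rewrite cim_expi sin_mulr2n sinu mulrCA -expr2 cosu zu cr.
by field.
Qed.

Lemma arg1 : arg (expi 0) = 0.
Proof. by rewrite /arg cim_expi sin0 mul0r atan0 mulr0. Qed.

Section BranchFilters.
Context {T : Type} {F : set_system T} {FF : Filter F}.
Implicit Types (f : T -> circle R).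

Lemma arg_cvg f z : cre z != -1 -> f @ F --> z -> arg (f x) @[x --> F] --> arg z.
Proof.
move=> zN1 fz; have z1 : 1 + cre z != 0 by rewrite addrC -[1]opprK subr_eq0.
have c : cim (f x) / (1 + cre (f x)) @[x --> F] --> (cim z / (1 + cre z)).
  apply: cvgM; first exact: cvg_cim.
  apply: cvgV => //; apply: cvgD; first exact: cvg_cst.
  exact: cvg_cre.
have ca := cvg_comp _ _ c (@continuous_atan R _).
exact: cvgM (cvg_cst _) ca.
Qed.

Lemma near_creN1 f z : cre z != -1 -> f @ F --> z ->
  \forall x \near F, cre (f x) != -1.
Proof.
move=> zN1 fz; have N : nbhs (cre z) [set x : R | x != -1].
  by apply: open_nbhs_nbhs; split => //; exact: open_neq.
exact: (cvg_cre fz N).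
Qed.

Lemma cre1N1 : cre (expi 0) != -1.
Proof. by rewrite cre_expi cos0; apply/eqP => h; lra. Qed.

(** The branch of the logarithm near [expi t] whose value at [expi t] is [t]. *)
Definition log_at t z := t + arg (circle_mul z (cinv (expi t))).

Lemma log_at_cvg f t : f @ F --> expi t -> log_at t (f x) @[x --> F] --> t.
Proof.
move=> ft; rewrite -[X in _ --> X]addr0 -arg1 -(cmulV (expi t)).
apply: cvgD; first exact: cvg_cst.
by apply: arg_cvg; [rewrite cmulV cre1N1 | apply: cmul_cvg => //; exact: cvg_cst].
Qed.

Lemma near_log_atK f t : f @ F --> expi t ->
  \forall x \near F, expi (log_at t (f x)) = f x.
Proof.
move=> ft; have c : circle_mul (f x) (cinv (expi t)) @[x --> F] --> expi 0.
  by rewrite -(cmulV (expi t)); apply: cmul_cvg => //; exact: cvg_cst.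
apply: filterS (near_creN1 cre1N1 c) => x xN1.
by rewrite /log_at expiD argK// cmulC cmulVK.
Qed.

End BranchFilters.

End Circle.

(** * The covering of the circle by the line: lifting and degrees *)

Section Covering.
Context {R : realType}.
Implicit Types (z w : circle R) (s t : R).

Lemma twopi_gt0 : 0 < 2 * pi :> R.
Proof. by rewrite mulr_gt0// pi_gt0. Qed.

Lemma expi2pi : expi (2 * pi) = expi 0 :> circle R.
Proof.
apply: circle_eqP; rewrite ?(cre_expi, cim_expi) mulr_natl.
  by rewrite cos2pi cos0.
by rewrite sin2pi sin0.
Qed.

Lemma expiDn t n : expi (t + 2 * pi *+ n) = expi t.
Proof.
elim: n => [|n IHn]; first by rewrite mulr0n addr0.
by rewrite mulrS addrCA addrC expiD IHn expi2pi cmul1.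
Qed.

Lemma expi_periodic t (k : int) : expi (t + 2 * pi * k%:~R) = expi t.
Proof.
rewrite mulrzr; case: k => n; first exact: expiDn.
by rewrite NegzE mulrNz -(expiDn _ n.+1) subrK.
Qed.

Lemma expi_reduce t : exists k : int, 0 <= t - 2 * pi * k%:~R < 2 * pi.
Proof.
exists (Num.floor (t / (2 * pi))); have p0 := twopi_gt0.
have /andP[h1 h2] := floor_itv (t / (2 * pi)).
rewrite subr_ge0 mulrC -ler_pdivlMr// h1/= ltrBlDr -[X in X + _]mul1r -mulrDl.
by rewrite -ltr_pdivrMr// addrC -[1]/(1%:~R) -intrD.
Qed.

(** cos is injective only on [0, pi]; beyond pi, it is applied to [2 * pi - t], which would have to
    vanish. *)
Lemma expi_eq1 t : 0 <= t < 2 * pi -> expi t = expi 0 -> t = 0.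
Proof.
move=> /andP[t0 t2] /(congr1 cre); rewrite !cre_expi cos0 => ct.
have p0 := pi_gt0 R; have [tp|tp] := leP t pi.
  by apply: cos_inj; rewrite ?in_itv/= ?lexx ?t0 ?tp ?pi_ge0// cos0.
suff : 2 * pi - t = 0 by move/eqP; rewrite subr_eq0 => /eqP te; lra.
apply: cos_inj; rewrite ?in_itv/= ?lexx ?pi_ge0//.
  by apply/andP; split; lra.
by rewrite cos0 -cosN opprB mulr_natl -(cosD2pi (t - _)) subrK.
Qed.

Lemma expi_inj s t : expi s = expi t -> exists k : int, s = t + 2 * pi * k%:~R.
Proof.
move=> e; have [k hk] := expi_reduce (s - t); exists k.
have : expi (s - t - 2 * pi * k%:~R) = expi 0.
  by rewrite -(expi_periodic _ k) subrK expiD expiN e cmulV.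
by move/(expi_eq1 hk)/eqP; rewrite subr_eq0 subr_eq addrC => /eqP.
Qed.

Lemma expi_surj z : exists2 t, 0 <= t <= 2 * pi & expi t = z.
Proof.
have [s <-] : exists s, expi s = z.
  have [zN1|zN1] := eqVneq (cre z) (-1); last by exists (arg z); exact: argK.
  exists pi; apply: circle_eqP; rewrite ?cre_expi ?cospi ?zN1// cim_expi sinpi.
  apply/esym/eqP; rewrite -sqrf_eq0 -(subrr (cre z ^+ 2 + cim z ^+ 2)).
  by rewrite cre2Dcim2 -subr_eq0 -{1}(cre2Dcim2 z) zN1; apply/eqP; ring.
have [k /andP[h1 h2]] := expi_reduce s; exists (s - 2 * pi * k%:~R).
  by rewrite h1 ltW.
by rewrite -(expi_periodic _ k) subrK.
Qed.

Lemma compact_circle : compact [set: circle R].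
Proof.
have -> : [set: circle R] = @expi R @` `[0, 2 * pi]%classic.
  apply/seteqP; split=> // z _; have [t tI <-] := expi_surj z.
  by exists t => //=; rewrite in_itv.
apply: continuous_compact; last exact: segment_compact.
by apply: continuous_subspaceT => t; exact: expi_continuous.
Qed.

(* A map out of the circle is continuous as soon as it is so on [0, 2 pi]:
   [expi] maps compact sets to closed sets. *)
Lemma circle_descend (Y : topologicalType) (psi : R -> Y) :
  continuous psi -> psi 0 = psi (2 * pi) ->
  exists2 Psi : circle R -> Y, continuous Psi &
    forall t, 0 <= t <= 2 * pi -> Psi (expi t) = psi t.
Proof.
move=> cpsi psi2.
pose sec z := xget 0 [set t | 0 <= t <= 2 * pi /\ expi t = z].
have secP z : 0 <= sec z <= 2 * pi /\ expi (sec z) = z.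
  apply: (@xgetPex _ 0 [set t | 0 <= t <= 2 * pi /\ expi t = z]).
  by have [t tI te] := expi_surj z; exists t.
have PsiE t : 0 <= t <= 2 * pi -> psi (sec (expi t)) = psi t.
  move=> tI; have [sI se] := secP (expi t).
  have red u : 0 <= u <= 2 * pi -> expi u = expi 0 -> psi u = psi 0.
    move=> /andP[u0]; rewrite le_eqVlt => /orP[/eqP->//|u2] ue.
    by rewrite (expi_eq1 _ ue)// u0.
  have [k sk] := expi_inj se.
  have [k0|k0] := eqVneq k 0; first by rewrite sk k0 mulr0 addr0.
  (* Two points of [0, 2 pi] that differ by a nonzero multiple of 2 pi are its two ends, where [psi]
     agrees. *)
  suff [st|ts] : sec (expi t) = 0 /\ t = 2 * pi \/ sec (expi t) = 2 * pi /\ t = 0.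
  - by rewrite st.1 st.2.
  - by rewrite ts.1 ts.2.
  have p0 := twopi_gt0.
  have : (1 <= k) || (k <= -1) by lia.
  case/orP=> kk.
    have : 1 <= k%:~R :> R by rewrite -[1]/(1%:~R) ler_int.
    by move=> /(ler_wpM2l (ltW p0)); rewrite mulr1 => ?; right; lra.
  have : k%:~R <= -1 :> R by rewrite -[-1]/((-1)%:~R) ler_int.
  by move=> /(ler_wpM2l (ltW p0)); rewrite mulrN1 => ?; left; lra.
exists (psi \o sec) => //; apply/continuous_closedP => C cC.
have -> : (psi \o sec) @^-1` C = @expi R @` (`[0, 2 * pi]%classic `&` psi @^-1` C).
  apply/seteqP; split=> [z Cz|_ [t [tI Ct] <-]].
    by exists (sec z); have [? ?] := secP z => //; split => //=; rewrite in_itv.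
  by move: tI; rewrite /= in_itv/= => tI; rewrite /= PsiE.
apply: compact_closed; first exact: circle_hausdorff.
apply: continuous_compact.
  by apply: continuous_subspaceT => t; exact: expi_continuous.
apply: compact_closedI; first exact: segment_compact.
exact: closed_comp.
Qed.

(** Retraction of the line onto a segment: it extends functions given on a segment or on a closed
    band to everywhere continuous ones. *)
Definition clamp (a b x : R) : R := Num.max a (Num.min x b).

Lemma clamp_itv (a b x : R) : a <= b -> a <= clamp a b x <= b.
Proof.
move=> ab; rewrite /clamp le_max lexx/= ge_max ab/=.
by rewrite ge_min lexx orbT.
Qed.

Lemma clamp_id (a b x : R) : a <= x <= b -> clamp a b x = x.
Proof.
by move=> /andP[ax xb]; rewrite /clamp; rewrite (min_idPl xb); exact/max_idPr.
Qed.

Lemma clamp_continuous (a b : R) : continuous (clamp a b).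
Proof.
move=> x; apply: (@continuous_max R R (fun=> a) (fun x => Num.min x b)).
  exact: cvg_cst.
by apply: (@continuous_min R R id (fun=> b)); [exact: cvg_id | exact: cvg_cst].
Qed.

Lemma cvg_pair_nbhs (T : Type) (F : set_system T) (FF : Filter F)
    (U V : topologicalType) (f : T -> U) (g : T -> V) (u : U) (v : V) :
  f @ F --> u -> g @ F --> v -> (f x, g x) @[x --> F] --> (u, v).
Proof. by move=> fu gv A nA; exact: (cvg_pair fu gv nA). Qed.

(* [phi] is the sum of the principal arguments of the quotients of F at
   consecutive points of a subdivision of [0, 1], fine enough for these
   quotients to avoid -1 above K. *)
Lemma homotopy_lift (X : topologicalType) (F : X * R -> circle R) (K : set X) :
  continuous F -> compact K ->
  exists phi : X -> R, (forall x, K x -> phi y @[y --> x] --> phi x) /\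
    forall x, K x -> F (x, 1) = circle_mul (F (x, 0)) (expi (phi x)).
Proof.
move=> cF cK.
have cKI : compact (K `*` `[0, 1 : R]%classic).
  by apply: compact_setX => //; exact: segment_compact.
pose G (e : R) (p : X * R) := circle_mul (F (p.1, p.2 + e)) (cinv (F p)).
(* Tube lemma: at [e = 0] the quotient is 1, so it avoids -1 near each point of the compact set,
   hence for a common small step [e]. *)
have : \forall e \near (0 : R), (K `*` `[0, 1 : R]%classic) `<=`
    (fun p => cre (G e p) != -1).
  apply: ((compact_near_coveringP _).1 cKI R (nbhs (0 : R))
    (fun e p => cre (G e p) != -1) _) => p _.
  have sh : (q.1.1, q.1.2 + q.2) @[q --> nbhs (p, 0 : R)] --> (p.1, p.2).
    apply: cvg_pair_nbhs; first exact: (cvg_comp _ _ cvg_fst cvg_fst).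
    rewrite -[X in _ --> X]addr0; apply: cvgD; last exact: cvg_snd.
    exact: (cvg_comp _ _ cvg_fst cvg_snd).
  have h1 : F (q.1.1, q.1.2 + q.2) @[q --> nbhs (p, 0 : R)] --> F p.
    by move: sh; rewrite -surjective_pairing => sh; exact: (cvg_comp _ _ sh (cF p)).
  have h2 : cinv (F q.1) @[q --> nbhs (p, 0 : R)] --> cinv (F p).
    have f1 : q.1 @[q --> nbhs (p, 0 : R)] --> p by exact: cvg_fst.
    exact: cinv_cvg (cvg_comp _ _ f1 (cF p)).
  have := near_creN1 _ (cmul_cvg h1 h2); rewrite cmulV.
  by move=> /(_ cre1N1 (nbhs_filter _)).
move=> /nbhs_ballP[d /= d0 hd].
have [N Nd] : exists N : nat, N.+1%:R^-1 < d.
  by have [N] := ltr_add_invr (d0 : 0 < d); rewrite add0r; exists N.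
have hF x (k : nat) : K x -> (k <= N)%N ->
    cre (circle_mul (F (x, k.+1%:R / N.+1%:R)) (cinv (F (x, k%:R / N.+1%:R)))) != -1.
  move=> Kx kN.
  have /hd/(_ (x, k%:R / N.+1%:R)) : ball (0 : R) d N.+1%:R^-1.
    by rewrite /ball/= sub0r normrN ger0_norm.
  have -> : k.+1%:R / N.+1%:R = k%:R / N.+1%:R + N.+1%:R^-1 :> R.
    by rewrite -natr1 mulrDl mul1r.
  apply; split => //=.
  rewrite in_itv/=; apply/andP; split; first by rewrite divr_ge0.
  by rewrite ler_pdivrMr// mul1r ler_nat leqW.
pose phi x := \sum_(k < N.+1)
  arg (circle_mul (F (x, k.+1%:R / N.+1%:R)) (cinv (F (x, k%:R / N.+1%:R)))).
exists phi; split=> x Kx.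
  rewrite /phi; apply: cvg_big => [|k _]; first exact: add_continuous.
  apply: (arg_cvg (hF _ _ Kx (leq_ord k))).
  have cFt (t : R) : F (y, t) @[y --> x] --> F (x, t).
    have h : (y, t) @[y --> x] --> (x, t).
      by apply: cvg_pair_nbhs; [exact: cvg_id | exact: cvg_cst].
    exact: (cvg_comp _ _ h (cF (x, t))).
  by apply: cmul_cvg; [exact: cFt | apply: cinv_cvg; exact: cFt].
have tel n : (n <= N.+1)%N -> F (x, n%:R / N.+1%:R) =
    circle_mul (F (x, 0)) (expi (\sum_(k < n)
  arg (circle_mul (F (x, k.+1%:R / N.+1%:R)) (cinv (F (x, k%:R / N.+1%:R)))))).
  elim: n => [|n IHn] nN; first by rewrite big_ord0 mul0r cmul1.
  rewrite big_ord_recr/= expiD cmulA -IHn ?(ltnW nN)// argK ?hF//.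
  by rewrite cmulC cmulVK.
by have := tel N.+1 (leqnn _); rewrite mulfV ?pnatr_eq0.
Qed.

(** A lift over [0, 2 pi] gains [2 * pi * d]. Since [is_degree] wants a lift on the whole line, the
    linear part [d * x] is removed, the rest descends to the circle, and the linear part is added
    back. *)
Lemma degree_exists (f : circle R -> circle R) :
  continuous f -> exists d, is_degree f d.
Proof.
(* At fixed [x], [F] runs along the loop from its base point; lifting this path up to time 1 gives
   the angle of [f (expi x)] relative to that of [f (expi 0)]. *)
move=> cf; pose F (p : R * R) := f (expi (p.1 * p.2)).
have cF : continuous F.
  move=> [x t]; have c : expi (p.1 * p.2) @[p --> (x, t)] --> expi (x * t).
    by apply: expi_cvg; apply: cvgM; [exact: cvg_fst | exact: cvg_snd].
  exact: (cvg_comp _ _ c (cf _)).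
have [phi [cphi Fphi]] := homotopy_lift cF (@segment_compact R 0 (2 * pi)).
have [t0 _ t0e] := expi_surj (f (expi 0)).
have p0 : 0 <= 2 * pi :> R by rewrite ltW// twopi_gt0.
pose theta x := t0 + phi (clamp 0 (2 * pi) x).
have ctheta : continuous theta.
  move=> x; apply: cvgD; first exact: cvg_cst.
  have h := @clamp_continuous 0 (2 * pi) x.
  by apply: (cvg_comp _ _ h); apply: cphi; rewrite /= in_itv/= clamp_itv.
have thetaE x : 0 <= x <= 2 * pi -> f (expi x) = expi (theta x).
  move=> xI; rewrite /theta clamp_id// expiD t0e.
  by have := Fphi x; rewrite /F /= mulr1 mulr0 in_itv/= => ->.
have [d de] : exists d : int, theta (2 * pi) = theta 0 + 2 * pi * d%:~R.
  apply: expi_inj; rewrite -!thetaE ?lexx ?p0//.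
  by rewrite expi2pi.
pose psi x := theta x - d%:~R * x.
have cpsi : continuous psi.
  move=> x; apply: cvgB; first exact: ctheta.
  by apply: cvgM; [exact: cvg_cst | exact: cvg_id].
have [|Psi cPsi PsiE] := circle_descend cpsi.
  by rewrite /psi de mulr0 subr0 [d%:~R * _]mulrC addrK.
exists d; exists (fun x => Psi (expi x) + d%:~R * x); split.
- move=> x; apply: cvgD; last by apply: cvgM; [exact: cvg_cst | exact: cvg_id].
  exact: (cvg_comp _ _ (@expi_continuous R x) (cPsi _)).
- move=> x; have [t tI te] := expi_surj (expi x).
  have [k xk] := expi_inj (esym te).
  rewrite -te PsiE// thetaE// /psi -[LHS](expi_periodic _ (d * k)) xk.
  by congr expi; rewrite intrM; ring.
- by rewrite expi2pi mulr0 addr0 mulrC.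
Qed.

(** Homotopy of maps from the circle to itself, in the form of a continuous logarithm of the
    quotient. *)
Definition csim (f g : circle R -> circle R) := exists2 phi : circle R -> R,
  continuous phi & forall z, f z = circle_mul (g z) (expi (phi z)).

(* No uniqueness of the degree is needed: [csim f g] makes the predicates
   [is_degree f] and [is_degree g] equal. *)
Lemma degree_csim (f g : circle R -> circle R) : continuous f -> continuous g ->
  degree f = degree g <-> csim f g.
Proof.
move=> cf cg; split=> [|fg].
  have := xgetPex 0 (degree_exists cf); have := xgetPex 0 (degree_exists cg).
  rewrite -/(degree f) -/(degree g) => -[tg [ctg gE tg2]] [tf [ctf fE tf2]] fg.
  (* The two lifts gain the same amount over a period, so their difference descends to the
     circle. *)
  pose psi x := tf x - tg x.
  have cpsi : continuous psi by move=> x; apply: cvgB; [exact: ctf | exact: ctg].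
  have [|Phi cPhi PhiE] := circle_descend cpsi.
    by rewrite /psi tf2 tg2 fg; ring.
  exists Phi => // z; have [t tI <-] := expi_surj z.
  by rewrite fE gE PhiE// -expiD; congr expi; rewrite /psi; ring.
have sub f' g' : csim f' g' -> is_degree g' `<=` is_degree f'.
  move=> [phi cphi fE] d [tg [ctg gE tg2]].
  exists (fun t => tg t + phi (expi t)); split.
  - move=> x; apply: cvgD; first exact: ctg.
    exact: (cvg_comp _ _ (@expi_continuous R x) (cphi _)).
  - by move=> t; rewrite fE gE expiD.
  - by rewrite tg2 expi2pi; ring.
rewrite /degree; congr (xget 0); apply/seteqP; split; last exact: sub.
apply: sub; case: fg => phi cphi fE; exists (fun z => - phi z).
  by move=> z; exact: (cvgN (cphi z)).
by move=> z; rewrite fE expiN cmulK.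
Qed.

Lemma homotopic_csim (F : circle R * R -> circle R) (s t : R) :
  continuous F -> csim (fun z => F (z, s)) (fun z => F (z, t)).
Proof.
move=> cF; pose G (p : circle R * R) := F (p.1, t + p.2 * (s - t)).
have cG : continuous G.
  move=> p; have c : (q.1, t + q.2 * (s - t)) @[q --> p] --> (p.1, t + p.2 * (s - t)).
    apply: cvg_pair_nbhs; first exact: cvg_fst.
    apply: cvgD; first exact: cvg_cst.
    by apply: cvgM; [exact: cvg_snd | exact: cvg_cst].
  exact: (cvg_comp _ _ c (cF _)).
have [phi [cphi Gphi]] := homotopy_lift cG compact_circle.
exists phi => [z|z]; first exact: cphi.
by have := Gphi z I; rewrite /G /= mul0r mul1r addr0 addrC subrK.
Qed.

End Covering.

(** * Unitary frames *)

Section Realification.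
Context {R : realType} {n : nat}.
Implicit Types (Z W : 'M[R[i]]_n).

Definition remx Z : 'M[R]_n := map_mx (@complex.Re R) Z.
Definition immx Z : 'M[R]_n := map_mx (@complex.Im R) Z.

(** A ring embedding that turns the conjugate transpose into the transpose, so that unitarity
    becomes orthogonality and [detC] is computed on the complex side. *)
Definition realify Z : 'M[R]_(n + n) :=
  block_mx (remx Z) (- immx Z) (immx Z) (remx Z).

Lemma Re_sum (I : Type) (r : seq I) (F : I -> R[i]) :
  complex.Re (\sum_(k <- r) F k) = \sum_(k <- r) complex.Re (F k).
Proof. by elim/big_rec2: _ => // k x y _ <-; case: (F k) => ? ?; case: y. Qed.

Lemma Im_sum (I : Type) (r : seq I) (F : I -> R[i]) :
  complex.Im (\sum_(k <- r) F k) = \sum_(k <- r) complex.Im (F k).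
Proof. by elim/big_rec2: _ => // k x y _ <-; case: (F k) => ? ?; case: y. Qed.

Lemma remxM Z W : remx (Z *m W) = remx Z *m remx W - immx Z *m immx W.
Proof.
apply/matrixP => i j; rewrite !mxE Re_sum -sumrB; apply: eq_bigr => k _.
by rewrite !mxE; case: (Z i k) => ? ?; case: (W k j).
Qed.

Lemma immxM Z W : immx (Z *m W) = immx Z *m remx W + remx Z *m immx W.
Proof.
apply/matrixP => i j; rewrite !mxE Im_sum -big_split; apply: eq_bigr => k _.
by rewrite /= !mxE; case: (Z i k) => ? ?; case: (W k j) => ? ?; rewrite /= addrC.
Qed.

Lemma realifyM Z W : realify (Z *m W) = realify Z *m realify W.
Proof.
rewrite /realify mulmx_block remxM immxM !mulNmx !mulmxN opprD.
by congr block_mx; rewrite addrC.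
Qed.

Lemma realify1 : realify 1%:M = 1%:M.
Proof.
rewrite [RHS]scalar_mx_block /realify; have -> : immx 1%:M = 0.
  by apply/matrixP => i j; rewrite !mxE; case: eqP.
have -> : remx 1%:M = 1%:M.
  by apply/matrixP => i j; rewrite !mxE; case: eqP.
by rewrite oppr0.
Qed.

Lemma complex_mx_realify Z :
  complex_mx (ulsubmx (realify Z)) (dlsubmx (realify Z)) = Z.
Proof.
rewrite /realify block_mxKul block_mxKdl; apply/matrixP => i j.
by rewrite !mxE; case: (Z i j).
Qed.

Lemma realify_inj : injective realify.
Proof. by move=> Z W e; rewrite -(complex_mx_realify Z) e complex_mx_realify. Qed.

Lemma realify_tr Z : (realify Z)^T = realify (map_mx Num.conj Z^T).
Proof.
rewrite /realify tr_block_mx.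
have -> : remx (map_mx Num.conj Z^T) = (remx Z)^T.
  by apply/matrixP => i j; rewrite !mxE; case: (Z j i).
have -> : immx (map_mx Num.conj Z^T) = - (immx Z)^T.
  by apply/matrixP => i j; rewrite !mxE; case: (Z j i).
by rewrite opprK linearN.
Qed.

Lemma detC_realify Z : detC (realify Z) = \det Z.
Proof. by rewrite /detC complex_mx_realify. Qed.

Lemma unitary_realP (C : 'M[R]_(n + n)) :
  unitary_real C <-> exists2 Z, Z \is unitarymx & C = realify Z.
Proof.
split=> [[A [B [-> U]]]|[Z U ->]].
  exists (complex_mx A B) => //; rewrite /realify.
  have -> : remx (complex_mx A B) = A by apply/matrixP => i j; rewrite !mxE.
  by have -> : immx (complex_mx A B) = B by apply/matrixP => i j; rewrite !mxE.
exists (remx Z), (immx Z); split; first by [].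
suff -> : complex_mx (remx Z) (immx Z) = Z by [].
by apply/matrixP => i j; rewrite !mxE; case: (Z i j).
Qed.

Lemma realify_unitary Z :
  (Z \is unitarymx) <-> realify Z *m (realify Z)^T = 1%:M.
Proof.
rewrite realify_tr -realifyM; split => [/unitarymxP ->|]; first exact: realify1.
by rewrite -realify1 => /realify_inj U; apply/unitarymxP.
Qed.

Lemma unitary_real1 : unitary_real (1%:M : 'M[R]_(n + n)).
Proof.
by apply/unitary_realP; exists 1%:M; rewrite ?realify1//; apply/unitarymxP;
  rewrite mul1mx trmx1 map_mx1.
Qed.

Lemma unitary_realM (C D : 'M[R]_(n + n)) :
  unitary_real C -> unitary_real D -> unitary_real (C *m D).
Proof.
move=> /unitary_realP[Z UZ ->] /unitary_realP[W UW ->].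
apply/unitary_realP; exists (Z *m W); first exact: mul_unitarymx.
by rewrite realifyM.
Qed.

Lemma unitary_real_tr (C : 'M[R]_(n + n)) :
  unitary_real C -> unitary_real C^T /\ C^T *m C = 1%:M.
Proof.
move=> /unitary_realP[Z UZ ->]; split.
  rewrite realify_tr; apply/unitary_realP; exists (map_mx Num.conj Z^T); last by [].
  by rewrite trmxC_unitary.
by apply: mulmx1C; apply/realify_unitary.
Qed.

Lemma detC1 : detC (1%:M : 'M[R]_(n + n)) = 1.
Proof. by rewrite -realify1 detC_realify det1. Qed.

Lemma detCM (C D : 'M[R]_(n + n)) : unitary_real C -> unitary_real D ->
  detC (C *m D) = detC C * detC D.
Proof.
move=> /unitary_realP[Z UZ ->] /unitary_realP[W UW ->].
by rewrite -realifyM !detC_realify det_mulmx.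
Qed.

Lemma norm_detC (C : 'M[R]_(n + n)) : unitary_real C -> `|detC C| = 1.
Proof.
move=> /unitary_realP[Z UZ ->]; rewrite detC_realify.
have /(congr1 determinant) := unitarymxP UZ.
by rewrite det_mulmx det_map_mx det_tr det1 -normCK => /eqP; rewrite sqrp_eq1// => /eqP.
Qed.

End Realification.

(** diag(z, 1, ..., 1), an explicit unitary matrix of determinant [z]; it needs a positive size,
    whence [n.+1]. *)
Definition circle_mx (R : realType) (n : nat) (z : circle R) :
    'M[R]_(n.+1 + n.+1) :=
  realify (diag_mx (\row_j (if j == 0 then val z else 1))).

Lemma circle_mx_unitary (R : realType) (n : nat) (z : circle R) :
  unitary_real (circle_mx n z).
Proof.
apply/unitary_realP; eexists; last by [].
apply/unitarymxP; rewrite tr_diag_mx map_diag_mx mulmx_diag; apply/matrixP => i j.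
rewrite !mxE; case: (i == j); last by rewrite !mulr0n.
case: (i == 0); first by rewrite -normCK (eqP (valP z)) expr1n.
by rewrite mul1r rmorph1.
Qed.

Lemma detC_circle_mx (R : realType) (n : nat) (z : circle R) :
  detC (circle_mx n z) = val z.
Proof.
rewrite detC_realify det_diag big_ord_recl mxE eqxx big1 ?mulr1// => j _.
by rewrite mxE.
Qed.

(** * Transition matrices of unitary frames and classes modulo EU(n) *)

Section UnitaryFrames.
Context {R : realType} {n : nat} {M : smooth_manifold R (n + n)}.
Context {om : symplectic_form M} {J : compatible_structure om}.
Implicit Types (p : M) (F H : 'M[R]_(n + n)) (f h : frame J) (x y : Gamma J).

(** The symmetry of g_J, read through the skewness of [om]. *)
Lemma omJ p : om p *m (J p)^T = - (J p *m om p).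
Proof.
have := acs_sym J p; rewrite /gJ trmx_mul omega_skew mulNmx => <-.
by rewrite opprK.
Qed.

Lemma JJ p m (A : 'M[R]_(m, n + n)) : A *m J p *m J p = - A.
Proof. by rewrite -mulmxA acs_sqr mulmxN mulmx1. Qed.

Lemma gJ_invariant p : J p *m gJ om J p *m (J p)^T = gJ om J p.
Proof.
by rewrite /gJ -!mulmxA omJ !mulmxN mulmxA acs_sqr mulNmx mul1mx opprK.
Qed.

Lemma gJ_gram p F : F *m gJ om J p *m F^T =
  block_mx (usubmx F *m gJ om J p *m (usubmx F)^T)
           (usubmx F *m gJ om J p *m (dsubmx F)^T)
           (dsubmx F *m gJ om J p *m (usubmx F)^T)
           (dsubmx F *m gJ om J p *m (dsubmx F)^T).
Proof.
by rewrite -[F in LHS]vsubmxK mul_col_mx tr_col_mx mul_col_row.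
Qed.

(** J is an isometry of g_J, so the block of the [v]s equals that of the [u]s; the remaining
    off-diagonal block is a transpose. *)
Lemma gJ_gram1 p F : dsubmx F = - (usubmx F *m J p) ->
  usubmx F *m gJ om J p *m (usubmx F)^T = 1%:M ->
  usubmx F *m gJ om J p *m (dsubmx F)^T = 0 -> F *m gJ om J p *m F^T = 1%:M.
Proof.
move=> vE uu uv; rewrite gJ_gram uu uv scalar_mx_block.
have := gJ_invariant p; have := acs_sym J p; move: (gJ _ _ _) uu uv => g uu uv gT gI.
have -> : dsubmx F *m g *m (usubmx F)^T = 0.
  by apply: trmx_inj; rewrite trmx0 !trmx_mul trmxK gT mulmxA.
rewrite vE linearN/= mulmxN mulNmx mulNmx opprK trmx_mul.
by rewrite !mulmxA -(mulmxA (usubmx F)) -(mulmxA (usubmx F)) gI uu.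
Qed.

Lemma unitary_frameE p F : is_unitary_frame J p F <->
  dsubmx F = - (usubmx F *m J p) /\ F *m gJ om J p *m F^T = 1%:M.
Proof.
split=> [[_ vE uu uv]|[vE e]]; first by split=> //; exact: gJ_gram1.
have FU : F \in unitmx by move: e; rewrite -mulmxA => /mulmx1_unit[].
by move: e; rewrite gJ_gram scalar_mx_block => /eq_block_mx[].
Qed.

Lemma fmatP f : dsubmx (fmat f) = - (usubmx (fmat f) *m J (fbase f)) /\
  fmat f *m gJ om J (fbase f) *m (fmat f)^T = 1%:M.
Proof. by apply/unitary_frameE; exact: (asboolW (valP f)). Qed.

Lemma fmat_unit f : fmat f \in unitmx.
Proof. by have [_] := fmatP f; rewrite -mulmxA => /mulmx1_unit[]. Qed.

Definition mkframe p F (h : is_unitary_frame J p F) : frame J :=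
  exist (fun x : M * 'M[R]_(n + n) => `[< is_unitary_frame J x.1 x.2 >])
    (p, F) (asboolT h).

(** Orthonormality survives because [C] is orthogonal, and the relation v = -Ju because [C] has the
    block form of a complex matrix. *)
Lemma frame_act_ex f C : unitary_real C -> exists h, frame_act f h C.
Proof.
move=> UC; have [_ CC] := unitary_real_tr UC.
case: UC => A [B [CE _]]; have [vE gE] := fmatP f.
have HP : is_unitary_frame J (fbase f) (C^T *m fmat f).
  apply/unitary_frameE; split; last first.
    transitivity (C^T *m (fmat f *m gJ om J (fbase f) *m (fmat f)^T) *m C).
      by rewrite trmx_mul trmxK !mulmxA.
    by rewrite gE mulmx1.
  rewrite -(vsubmxK (fmat f)) CE tr_block_mx mul_block_col.
  rewrite col_mxKd col_mxKu vE linearN/= mulmxDl !mulmxN !mulNmx.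
  by rewrite -(mulmxA B^T) JJ mulmxN opprK opprD (mulmxA A^T) addrC.
by exists (mkframe HP).
Qed.

(** The transition matrix [D] consists of the g_J-products of the vectors of [h] with those of [f].
    It is orthogonal as both frames are orthonormal, and has the block form of a complex matrix as
    both satisfy v = -Ju. *)
Lemma frame_rel f h : fbase h = fbase f ->
  exists2 C, unitary_real C & frame_act f h C.
Proof.
move=> b; have [vE gE] := fmatP f; have [vE' gE'] := fmatP h; rewrite b in vE' gE'.
have Jg : J (fbase f) *m gJ om J (fbase f) = - om (fbase f).
  by rewrite /gJ mulmxA acs_sqr mulNmx mul1mx.
have gJT : gJ om J (fbase f) *m (J (fbase f))^T = om (fbase f).
  by rewrite /gJ -mulmxA omJ mulmxN mulmxA acs_sqr mulNmx mul1mx opprK.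
have gI := gJ_invariant (fbase f); have gT := acs_sym J (fbase f).
set p := fbase f in b vE gE vE' gE' Jg gJT gI gT.
set g := gJ om J p in gE gE' Jg gJT gI gT; clearbody g.
(* Expansion of a tangent vector in the orthonormal frame [f]. *)
have gF : g *m (fmat f)^T *m fmat f = 1%:M by apply: mulmx1C; rewrite mulmxA.
pose D := fmat h *m g *m (fmat f)^T.
have DF : D *m fmat f = fmat h by rewrite /D -!mulmxA (mulmxA g) gF mulmx1.
have DD : D *m D^T = 1%:M.
  rewrite /D !trmx_mul trmxK gT !mulmxA -(mulmxA (_ *m g)).
  by rewrite -(mulmxA (_ *m g)) -!mulmxA (mulmxA g) (mulmxA (g *m _)) gF mul1mx mulmxA.
pose u := usubmx (fmat f); pose u' := usubmx (fmat h).
pose a := u' *m g *m u^T; pose b' := - (u' *m om p *m u^T).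
have DE : D = block_mx a b' (- b') a.
  rewrite /D -(vsubmxK (fmat f)) -(vsubmxK (fmat h)) mul_col_mx tr_col_mx.
  rewrite mul_col_row -/u -/u' vE vE' -/u -/u'; congr block_mx.
  - by rewrite linearN/= mulmxN trmx_mul mulmxA -(mulmxA u') gJT.
  - by rewrite !mulNmx -(mulmxA u') Jg /b' mulmxN mulNmx.
  - rewrite linearN/= mulmxN !mulNmx opprK trmx_mul mulmxA -(mulmxA u').
    by rewrite -(mulmxA u' _ (J p)^T) gI.
exists D^T; last by split => //; rewrite trmxK DF.
have DT : D^T = block_mx a^T (- b'^T) b'^T a^T.
  by rewrite DE tr_block_mx linearN.
have -> : D^T = realify (complex_mx a^T b'^T).
  by rewrite DT /realify; congr block_mx; apply/matrixP => i j; rewrite !mxE.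
apply/unitary_realP; exists (complex_mx a^T b'^T) => //.
apply/realify_unitary.
have <- : D^T = realify (complex_mx a^T b'^T).
  by rewrite DT /realify; congr block_mx; apply/matrixP => i j; rewrite !mxE.
by rewrite trmxK; exact: mulmx1C.
Qed.

Lemma frame_act1 f : frame_act f f 1%:M.
Proof. by split; rewrite ?trmx1 ?mul1mx. Qed.

Lemma frame_act_trans f h k C D :
  frame_act f h C -> frame_act h k D -> frame_act f k (C *m D).
Proof.
move=> [b m] [b' m']; split; first by rewrite b'.
by rewrite m' m trmx_mul mulmxA.
Qed.

Lemma frame_act_sym f h C : unitary_real C -> frame_act f h C -> frame_act h f C^T.
Proof.
move=> UC [b m]; split => //; rewrite trmxK m mulmxA.
by have [_ /mulmx1C ->] := unitary_real_tr UC; rewrite mul1mx.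
Qed.

Lemma frame_act_matrix f h C : frame_act f h C -> (fmat h *m invmx (fmat f))^T = C.
Proof. by move=> [_ ->]; rewrite mulmxK ?fmat_unit// trmxK. Qed.

(** EU(n) is the kernel of the homomorphism [detC ^+ 2] on U(n); in this form membership is stable
    under products at sight. *)
Lemma eunitary_sqr (C : 'M[R]_(n + n)) : unitary_real C ->
  eunitary_real C <-> detC C ^+ 2 = 1.
Proof.
move=> UC; split=> [[_ [] ->]|/eqP]; rewrite ?sqrrN ?expr1n//.
by rewrite sqrf_eq1 => /orP[] /eqP; split => //; [left|right].
Qed.

Lemma EU_orbit_refl f : EU_orbit f f.
Proof.
exists 1%:M; last exact: frame_act1.
by split; [exact: unitary_real1 | left; exact: detC1].
Qed.

Lemma gclass_eqP f h : gclass f = gclass h <-> EU_orbit f h.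
Proof.
split=> [[->]|[C [UC dC] fh]]; first exact: EU_orbit_refl.
apply/val_inj => /=; apply/seteqP; split=> k.
- move=> [D [UD dD] fk]; have [UCT _] := unitary_real_tr UC.
  have U : unitary_real (C^T *m D) by exact: unitary_realM.
  exists (C^T *m D); last exact: frame_act_trans (frame_act_sym UC fh) fk.
  apply/(eunitary_sqr U).
  have CC : detC C^T * detC C = 1.
    by rewrite -detCM//; have [_ ->] := unitary_real_tr UC; exact: detC1.
  rewrite detCM// exprMn; have /(eunitary_sqr UD) -> : eunitary_real D by [].
  have /(eunitary_sqr UC) C2 : eunitary_real C by [].
  by rewrite mulr1 -[LHS]mulr1 -C2 -exprMn CC expr1n.
- move=> [D [UD dD] hk]; have U : unitary_real (C *m D) by exact: unitary_realM.
  exists (C *m D); last exact: frame_act_trans fh hk.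
  apply/(eunitary_sqr U); rewrite detCM// exprMn.
  have /(eunitary_sqr UD) -> : eunitary_real D by [].
  by have /(eunitary_sqr UC) -> : eunitary_real C by []; rewrite mulr1.
Qed.

Lemma gclass_surj x : exists f, x = gclass f.
Proof.
have [f fE] := asboolW (valP x); exists f; exact: val_inj.
Qed.

Lemma gbaseE f : gbase (gclass f) = fbase f.
Proof.
rewrite /gbase; case: cid => h /= e.
have : EU_orbit f h by rewrite e; exact: EU_orbit_refl.
by case=> C _ [].
Qed.

(** [gact] picks some frame and some matrix. Another choice changes the result by [C^T *m (E *m C')]
    with [E] in EU(n), whose squared determinant is 1 because determinants commute. *)
Lemma gactE f h C (z : circle R) : unitary_real C -> detC C ^+ 2 = val z ->
  frame_act f h C -> gact (gclass f) z = gclass h.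
Proof.
move=> UC dC fh; rewrite /gact; set S := [set y | _].
have : S (xget (gclass f) S) by apply: (@xgetPex _ _ S); exists (gclass h), f, h, C.
move=> [f' [h' [C' [UC' dC' fh' e ->]]]].
apply/esym/gclass_eqP; move/gclass_eqP: e => [E EU ff'].
have UE := EU.1; have [UCT CC] := unitary_real_tr UC.
have U : unitary_real (C^T *m (E *m C')) by do 2 apply: unitary_realM => //.
exists (C^T *m (E *m C')).
  apply/(eunitary_sqr U); rewrite !detCM ?exprMn//; last exact: unitary_realM.
  move/(eunitary_sqr UE) : EU => ->; rewrite mul1r dC' -dC -exprMn -detCM// CC.
  by rewrite detC1 expr1n.
apply: frame_act_trans (frame_act_sym UC fh) _.
exact: frame_act_trans ff' fh'.
Qed.

(** Orthogonality of the [u]s and [v]s is the Lagrangian condition: g_J(u, Ju') = omega(Ju, Ju') =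
    omega(u, u'). *)
Lemma frame_of_lagrangian p (u : 'M[R]_(n, n + n)) :
  u *m gJ om J p *m u^T = 1%:M -> u *m om p *m u^T = 0 ->
  is_unitary_frame J p (col_mx u (- (u *m J p))).
Proof.
move=> uu uw; rewrite /is_unitary_frame col_mxKu col_mxKd.
have uv : u *m gJ om J p *m (- (u *m J p))^T = 0.
  rewrite linearN/= mulmxN trmx_mul mulmxA /gJ -!mulmxA (mulmxA (om p)) omJ.
  rewrite !mulNmx !mulmxN (mulmxA (J p)) (mulmxA (J p) (J p)) acs_sqr.
  by rewrite !mulNmx mul1mx !mulmxN opprK !mulmxA uw oppr0.
have : col_mx u (- (u *m J p)) *m gJ om J p *m (col_mx u (- (u *m J p)))^T = 1%:M.
  by apply: gJ_gram1; rewrite ?col_mxKu ?col_mxKd.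
by rewrite -mulmxA => /mulmx1_unit[].
Qed.

(** Unitary frames of one Lagrangian plane differ by a real matrix, whose determinant is real of
    modulus 1 and hence has square 1. This makes det_J^2 well defined. *)
Lemma frame_span_inj f h : fbase f = fbase h -> frame_span f = frame_span h ->
  gclass f = gclass h.
Proof.
move=> b sp; have [C UC fh] := frame_rel (esym b).
apply/gclass_eqP; exists C; last by [].
have /unitary_realP[Z UZ CZ] := UC.
have [_] := fmatP f; rewrite gJ_gram scalar_mx_block => /eq_block_mx[uu uv _ vv].
have /submxP[D hD] : (usubmx (fmat h) <= usubmx (fmat f))%MS.
  apply/row_subP => i; have : frame_span h (row i (usubmx (fmat h))).
    by exists (delta_mx 0 i); rewrite -rowE.
  by rewrite -sp => -[c ->]; exact: submxMl.
have hE : usubmx (fmat h) =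
    (remx Z)^T *m usubmx (fmat f) + (immx Z)^T *m dsubmx (fmat f).
  have [_ ->] := fh; rewrite CZ -[fmat f in LHS]vsubmxK tr_block_mx.
  by rewrite mul_block_col col_mxKu.
(* The products of the [u]s of [h] with the [v]s of [f] compute the imaginary part; they vanish
   since the former are combinations of the [u]s of [f]. *)
have imZ : immx Z = 0.
  apply: trmx_inj; rewrite trmx0 -[LHS]mulmx1 -vv -(mul0mx _ 1%:M).
  have e : D *m (usubmx (fmat f) *m gJ om J (fbase f) *m (dsubmx (fmat f))^T) =
      (remx Z)^T *m (usubmx (fmat f) *m gJ om J (fbase f) *m (dsubmx (fmat f))^T) +
      (immx Z)^T *m (dsubmx (fmat f) *m gJ om J (fbase f) *m (dsubmx (fmat f))^T).
    by rewrite !mulmxA -hD hE !mulmxDl.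
  by rewrite mul0mx; move: e; rewrite uv !mulmx0 add0r => <-.
have cZ : map_mx Num.conj Z = Z.
  apply/matrixP => i j; move/matrixP/(_ i j): imZ; rewrite !mxE.
  by case: (Z i j) => x y /= ->; rewrite /Num.conj /= oppr0.
have := norm_detC UC; rewrite CZ detC_realify => dZ.
apply/(eunitary_sqr); first by rewrite -CZ.
rewrite detC_realify expr2 -{2}cZ det_map_mx -normCK dZ expr1n.
by [].
Qed.

End UnitaryFrames.

(** * Limits and charts *)

Lemma cvg_near_eq (T : Type) (F : set_system T) (FF : Filter F)
    (U : topologicalType) (f g : T -> U) (l : U) :
  (\forall t \near F, f t = g t) -> f @ F --> l -> g @ F --> l.
Proof. by move=> fg; apply: cvg_trans; apply: near_eq_cvg. Qed.

Section MatrixLimits.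
Context {R : realType} {T : Type} {F : set_system T} {FF : Filter F}.

Lemma mx_cvg m n (f : T -> 'M[R]_(m, n)) (A : 'M[R]_(m, n)) :
  (forall i j, f t i j @[t --> F] --> A i j) -> f @ F --> A.
Proof.
move=> fA U [P AP PU]; suff : \forall t \near F, forall i j, P i j (f t i j).
  by apply: filterS => t Pt; exact: PU.
apply: filter_forall => i; apply: filter_forall => j.
exact: fA (AP i j).
Qed.

Lemma mx_coord_cvg m n (f : T -> 'M[R]_(m, n)) (A : 'M[R]_(m, n)) i j :
  f @ F --> A -> f t i j @[t --> F] --> A i j.
Proof. by move=> fA; exact: (cvg_comp _ _ fA (@coord_continuous _ _ _ i j A)). Qed.

Lemma cvg_sum n (f : 'I_n -> T -> R) (a : 'I_n -> R) :
  (forall k, f k @ F --> a k) -> \sum_k f k t @[t --> F] --> \sum_k a k.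
Proof. by move=> fa; apply: cvg_big => [|k _]; [exact: add_continuous | exact: fa]. Qed.

Lemma mulmx_cvg m n p (f : T -> 'M[R]_(m, n)) (g : T -> 'M[R]_(n, p))
    (A : 'M[R]_(m, n)) (B : 'M[R]_(n, p)) :
  f @ F --> A -> g @ F --> B -> f t *m g t @[t --> F] --> A *m B.
Proof.
move=> fA gB; apply: mx_cvg => i j; rewrite mxE; under eq_fun do rewrite mxE.
by apply: cvg_sum => k; apply: cvgM; exact: mx_coord_cvg.
Qed.

Lemma trmx_cvg m n (f : T -> 'M[R]_(m, n)) (A : 'M[R]_(m, n)) :
  f @ F --> A -> (f t)^T @[t --> F] --> A^T.
Proof.
move=> fA; apply: mx_cvg => i j; rewrite mxE; under eq_fun do rewrite mxE.
exact: mx_coord_cvg.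
Qed.

Lemma oppmx_cvg m n (f : T -> 'M[R]_(m, n)) (A : 'M[R]_(m, n)) :
  f @ F --> A -> - f t @[t --> F] --> - A.
Proof.
move=> fA; apply: mx_cvg => i j; rewrite mxE; under eq_fun do rewrite mxE.
by apply: cvgN; exact: mx_coord_cvg.
Qed.

Lemma col_mx_cvg m n p (f : T -> 'M[R]_(m, n)) (g : T -> 'M[R]_(p, n))
    (A : 'M[R]_(m, n)) (B : 'M[R]_(p, n)) :
  f @ F --> A -> g @ F --> B -> col_mx (f t) (g t) @[t --> F] --> col_mx A B.
Proof.
move=> fA gB; apply: mx_cvg => i j; rewrite mxE; under eq_fun do rewrite mxE.
by case: (fintype.split i) => k; exact: mx_coord_cvg.
Qed.

Lemma det_cvg n (f : T -> 'M[R]_n) (A : 'M[R]_n) :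
  f @ F --> A -> \det (f t) @[t --> F] --> \det A.
Proof.
move=> fA; rewrite /determinant; apply: cvg_big => [|s _]; first exact: add_continuous.
apply: cvgM; first exact: cvg_cst.
by apply: cvg_big => [|i _]; [exact: mul_continuous | exact: mx_coord_cvg].
Qed.

Lemma adjmx_cvg n (f : T -> 'M[R]_n) (A : 'M[R]_n) :
  f @ F --> A -> \adj (f t) @[t --> F] --> \adj A.
Proof.
move=> fA; apply: mx_cvg => i j; rewrite mxE; under eq_fun do rewrite mxE.
rewrite /cofactor; apply: cvgM; first exact: cvg_cst.
apply: det_cvg; apply: mx_cvg => k l; rewrite !mxE.
by under eq_fun do rewrite !mxE; exact: mx_coord_cvg.
Qed.

(** Cramer's formula. [invmx] returns a singular matrix unchanged, whence the condition that [f t]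
    be invertible near the limit. *)
Lemma invmx_cvg n (f : T -> 'M[R]_n) (A : 'M[R]_n) : A \in unitmx ->
  (\forall t \near F, f t \in unitmx) ->
  f @ F --> A -> invmx (f t) @[t --> F] --> invmx A.
Proof.
move=> UA Uf fA; rewrite /invmx UA.
have dA : \det A != 0 by move: UA; rewrite unitmxE unitfE.
have c : (\det (f t))^-1 *: \adj (f t) @[t --> F] --> (\det A)^-1 *: \adj A.
  apply: mx_cvg => i j; rewrite mxE; under eq_fun do rewrite mxE.
  apply: cvgM; first by apply: cvgV => //; exact: det_cvg.
  by apply: mx_coord_cvg; exact: adjmx_cvg.
apply: (cvg_near_eq FF _ c).
by apply: filterS Uf => t ->.
Qed.

(** Complex limits are expressed by their two real coordinates; [ccvg] is stable under sums and
    products, and the determinant is a polynomial in the entries. *)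
Lemma complex_det_cvg n (f : T -> 'M[R[i]]_n) (Z : 'M[R[i]]_n) :
  (forall i j, complex.Re (f t i j) @[t --> F] --> complex.Re (Z i j)) ->
  (forall i j, complex.Im (f t i j) @[t --> F] --> complex.Im (Z i j)) ->
  complex.Re (\det (f t)) @[t --> F] --> complex.Re (\det Z) /\
  complex.Im (\det (f t)) @[t --> F] --> complex.Im (\det Z).
Proof.
move=> cr ci.
pose ccvg (g : T -> R[i]) (z : R[i]) := complex.Re (g t) @[t --> F] --> complex.Re z /\
  complex.Im (g t) @[t --> F] --> complex.Im z.
have ccvgM g h z w : ccvg g z -> ccvg h w -> ccvg (fun t => g t * h t) (z * w).
  move=> [gr gi] [hr hi]; split.
    have -> : (fun t => complex.Re (g t * h t)) = (fun t =>
        complex.Re (g t) * complex.Re (h t) - complex.Im (g t) * complex.Im (h t)).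
      by apply/funext => t; case: (g t) => ? ?; case: (h t).
    have -> : complex.Re (z * w) =
        complex.Re z * complex.Re w - complex.Im z * complex.Im w.
      by case: (z) => ? ?; case: (w).
    by apply: cvgB; exact: cvgM.
  have -> : (fun t => complex.Im (g t * h t)) = (fun t =>
      complex.Re (g t) * complex.Im (h t) + complex.Im (g t) * complex.Re (h t)).
    by apply/funext => t; case: (g t) => ? ?; case: (h t).
  have -> : complex.Im (z * w) =
      complex.Re z * complex.Im w + complex.Im z * complex.Re w.
    by case: (z) => ? ?; case: (w).
  by apply: cvgD; exact: cvgM.
have ccst z : ccvg (fun=> z) z by split; exact: cvg_cst.
have cprod m (g : 'I_m -> T -> R[i]) z : (forall k, ccvg (g k) (z k)) ->
    ccvg (fun t => \prod_k g k t) (\prod_k z k).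
  elim: m g z => [|m IHm] g z gz.
    by rewrite big_ord0; under [X in ccvg X]eq_fun do rewrite big_ord0; exact: ccst.
  rewrite big_ord_recl; under [X in ccvg X]eq_fun do rewrite big_ord_recl.
  by apply: (ccvgM _ _ _ _ (gz _)); exact: IHm.
have csum (I : finType) (g : I -> T -> R[i]) z : (forall k, ccvg (g k) (z k)) ->
    ccvg (fun t => \sum_k g k t) (\sum_k z k).
  move=> gz; split; rewrite ?Re_sum ?Im_sum.
    under eq_fun do rewrite Re_sum.
    by apply: cvg_big => [|k _]; [exact: add_continuous | case: (gz k)].
  under eq_fun do rewrite Im_sum.
  by apply: cvg_big => [|k _]; [exact: add_continuous | case: (gz k)].
rewrite -/(ccvg _ _) /determinant; apply: csum => s; apply: (ccvgM _ _ _ _ (ccst _)).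
by apply: cprod => k; split; [exact: cr | exact: ci].
Qed.

Lemma detC_cvg n (f : T -> 'M[R]_(n + n)) (A : 'M[R]_(n + n)) : f @ F --> A ->
  complex.Re (detC (f t)) @[t --> F] --> complex.Re (detC A) /\
  complex.Im (detC (f t)) @[t --> F] --> complex.Im (detC A).
Proof.
move=> fA; apply: complex_det_cvg => i j; rewrite !mxE /=.
  by under eq_fun do rewrite !mxE /=; exact: mx_coord_cvg.
by under eq_fun do rewrite !mxE /=; exact: mx_coord_cvg.
Qed.

End MatrixLimits.

(** * Jacobian matrices in the row convention *)

Section Jacobians.
Context {R : realType}.

Lemma row_jacobian m n (f : 'rV[R]_m -> 'rV[R]_n) x i :
  differentiable f x -> row i (jacobian f x) = 'D_(delta_mx 0 i) f x.
Proof. by move=> df; rewrite rowE (deriveEjacobian _ df). Qed.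

(** Rows are the images of the coordinate vectors, so the chain rule multiplies from left to
    right. *)
Lemma jacobian_comp m n p (f : 'rV[R]_m -> 'rV[R]_n) (g : 'rV[R]_n -> 'rV[R]_p) x :
  differentiable f x -> differentiable g (f x) ->
  jacobian (g \o f) x = jacobian f x *m jacobian g (f x).
Proof.
move=> df dg; have dgf := differentiable_comp df dg.
apply/row_matrixP => i; rewrite !rowE mulmxA.
rewrite -(deriveEjacobian _ dgf) -(deriveEjacobian _ df) -(deriveEjacobian _ dg).
by rewrite (deriveE _ dgf) (deriveE _ df) (deriveE _ dg) diff_comp.
Qed.

Lemma jacobian_near_eq m n (f g : 'rV[R]_m -> 'rV[R]_n) x :
  differentiable f x -> differentiable g x -> (\near x, f x = g x) ->
  jacobian f x = jacobian g x.
Proof.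
move=> df dg fg; apply/row_matrixP => i.
apply: etrans (row_jacobian i df) _; apply: etrans (esym (row_jacobian i dg)).
exact: near_eq_derive.
Qed.

Lemma differentiable_idfun m (x : 'rV[R]_m) : differentiable id x.
Proof. exact: ex_diff. Qed.

Lemma jacobian_id m (x : 'rV[R]_m) : jacobian id x = 1%:M.
Proof.
apply/row_matrixP => i; rewrite (row_jacobian _ (differentiable_idfun x)) derive_id.
by rewrite rowE mulmx1.
Qed.

Lemma smooth_differentiable m (W : normedModType R) A (f : 'rV[R]_m -> W) x :
  smooth_on A f -> A x -> differentiable f x.
Proof. by move=> /(_ 1%N)[df _]; exact: df. Qed.

Lemma smooth_continuous m (W : normedModType R) A (f : 'rV[R]_m -> W) x :
  smooth_on A f -> A x -> f y @[y --> x] --> f x.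
Proof. by move=> /(_ 0%N); apply. Qed.

Lemma smooth_jacobian_cvg m n (A : set 'rV[R]_m) (f : 'rV[R]_m -> 'rV[R]_n) x :
  open A -> smooth_on A f -> A x -> jacobian f y @[y --> x] --> jacobian f x.
Proof.
move=> oA sf Ax; apply: (@mx_cvg _ _ _ (nbhs_filter x)) => i j.
have DE y : A y -> jacobian f y i j = 'D_(delta_mx 0 i) f y 0 j.
  by move=> Ay; rewrite -(row_jacobian _ (smooth_differentiable sf Ay)) [RHS]mxE.
have c : 'D_(delta_mx 0 i) f y 0 j @[y --> x] --> 'D_(delta_mx 0 i) f x 0 j.
  by apply: mx_coord_cvg; have [_ /(_ (delta_mx 0 i))] := sf 1%N; apply.
have nA : \forall y \near x, A y by apply: open_nbhs_nbhs; split.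
have ext (h k : 'rV[R]_m -> R) : (forall y, A y -> h y = k y) ->
    k y @[y --> x] --> k x -> h y @[y --> x] --> h x.
  move=> hk kx; rewrite (hk _ Ax); apply: (cvg_near_eq (nbhs_filter x) _ kx).
  by apply: (filterS _ nA) => y Ay; rewrite (hk _ Ay).
exact: (ext (fun y => jacobian f y i j) _ DE c).
Qed.

End Jacobians.

(** * Charts and the cocycle of coordinate changes *)

Section Charts.
Context {R : realType} {m : nat} {M : smooth_manifold R m}.
Implicit Types (p q : M) (i j k : chart_ix M).

Lemma near_dom i p : dom i p -> \forall q \near p, dom i q.
Proof. by move=> ip; apply: open_nbhs_nbhs; split => //; exact: dom_open. Qed.

Lemma chart_cvg i p : dom i p -> chart i q @[q --> p] --> chart i p.
Proof.
move=> ip; have := @chart_continuous _ _ M i.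
by rewrite continuous_open_subspace; [apply; rewrite inE | exact: dom_open].
Qed.

Lemma chart_inv_cvg i p : dom i p -> chart_inv i x @[x --> chart i p] --> p.
Proof.
move=> ip; have := @chart_inv_continuous _ _ M i.
rewrite continuous_open_subspace; last exact: chart_open.
by move/(_ (chart i p)); rewrite inE /continuous_at chartK//; apply; exists p.
Qed.

Lemma near_chart i p (A : set M) : dom i p -> nbhs p A ->
  \forall x \near chart i p, exists2 q, dom i q /\ A q & x = chart i q.
Proof.
move=> ip nA; have no : \forall x \near chart i p, (chart i @` dom i) x.
  by apply: open_nbhs_nbhs; split; [exact: chart_open | exists p].
have nB := chart_inv_cvg ip nA.
near=> x; have [q iq qx] : (chart i @` dom i) x by near: x.
exists q => //; split=> //.
have : A (chart_inv i x) by near: x.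
by rewrite -qx chartK.
Unshelve. all: by end_near. Qed.

Lemma transition_open i j : open (chart i @` (dom i `&` dom j) : set 'rV[R]_m).
Proof.
rewrite openE => _ [p [ip jp] <-]; rewrite /interior.
apply: filterS (near_chart ip (near_dom jp)) => x [q [iq jq] ->].
by exists q.
Qed.

Lemma transition_differentiable i j p : dom i p -> dom j p ->
  differentiable (chart j \o chart_inv i) (chart i p).
Proof.
by move=> ip jp; apply: (smooth_differentiable (chart_smooth i j)); exists p.
Qed.

(** Near [chart i p] the transition from [i] to [k] factors through [j], and the chain rule
    applies. *)
Lemma changeM i j k p : dom i p -> dom j p -> dom k p ->
  change i j p *m change j k p = change i k p.
Proof.
move=> ip jp kp.
have ep : (chart j \o chart_inv i) (chart i p) = chart j p by rewrite /= chartK.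
have d1 := transition_differentiable ip jp.
have d2 : differentiable (chart k \o chart_inv j) ((chart j \o chart_inv i) (chart i p)).
  by rewrite ep; exact: transition_differentiable.
have e : \forall x \near chart i p, (chart k \o chart_inv i) x =
    ((chart k \o chart_inv j) \o (chart j \o chart_inv i)) x.
  apply: filterS (near_chart ip (near_dom jp)) => x [q [iq jq] ->] /=.
  by rewrite !chartK.
have E := jacobian_near_eq (transition_differentiable ip kp)
  (differentiable_comp d1 d2) e.
apply: esym; apply: etrans E _; apply: etrans (jacobian_comp d1 d2) _.
exact (congr1 (fun y => change i j p *m jacobian (chart k \o chart_inv j) y) ep).
Qed.

Lemma change1 i p : dom i p -> change i i p = 1%:M.
Proof.
move=> ip.
have e : \forall x \near chart i p, (chart i \o chart_inv i) x = id x.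
  by apply: filterS (near_chart ip (near_dom ip)) => x [q [iq _] ->] /=; rewrite chartK.
apply: etrans (jacobian_id (chart i p)).
exact: (jacobian_near_eq (transition_differentiable ip ip) (differentiable_idfun _) e).
Qed.

Lemma change_cvg i j p : dom i p -> dom j p ->
  change i j q @[q --> p] --> change i j p.
Proof.
move=> ip jp; apply: (cvg_comp _ _ (chart_cvg ip)).
apply: (smooth_jacobian_cvg (@transition_open i j) (chart_smooth i j)).
by exists p.
Qed.

Lemma change_unit i j p : dom i p -> dom j p -> change i j p \in unitmx.
Proof.
move=> ip jp.
exact: (mulmx1_unit (etrans (changeM ip jp ip) (change1 ip))).1.
Qed.

End Charts.

(* Unfolding these makes the unifier compare derivatives and diverge. *)
#[local] Opaque change jacobian.

(** * Topology of the circle bundle *)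

Lemma fst_cvg (U V : topologicalType) (q : U * V) :
  q'.1 @[q' --> nbhs q] --> q.1.
Proof. by case: q => u v; exact: cvg_fst. Qed.

Lemma snd_cvg (U V : topologicalType) (q : U * V) :
  q'.2 @[q' --> nbhs q] --> q.2.
Proof. by case: q => u v; exact: cvg_snd. Qed.

Section FrameTopology.
Context {R : realType} {n : nat} {M : smooth_manifold R (n + n)}.
Context {om : symplectic_form M} {J : compatible_structure om}.
Implicit Types (p : M) (f h : frame J) (x y : Gamma J) (i j : chart_ix M).

Lemma frame_coord_change i j f : dom i (fbase f) -> dom j (fbase f) ->
  frame_coord i f =
  (fbase f, (frame_coord j f).2 *m change j i (fbase f)).
Proof.
move=> fi fj; have E := esym (changeM (chart_atP (fbase f)) fj fi).
have E' := etrans (congr1 (mulmx (fmat f)) E) (mulmxA _ _ _).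
exact (congr1 (fun c => (fbase f, c)) E').
Qed.

(** Openness is tested in all charts, but one chart is enough for limits: on an overlap the
    coordinates differ by [change], which varies continuously. *)
Lemma frame_coord_cvgE (T : Type) (F : set_system T) (FF : Filter F)
    (e : T -> frame J) h i : dom i (fbase h) ->
  e @ F --> h <-> frame_coord i (e t) @[t --> F] --> frame_coord i h.
Proof.
move=> hi; split=> eh U; rewrite nbhsE => -[W [oW Wh] WU]; last first.
  have [V oV WV] := oW i; have Vh : nbhs (frame_coord i h) V.
    by apply: open_nbhs_nbhs; split => //; apply/WV.
  have di : nbhs (frame_coord i h) [set q | dom i q.1].
    exact: (@fst_cvg _ _ (frame_coord i h) _ (near_dom hi)).
  by apply: (@filterS2 _ F FF _ _ _ _ (eh _ Vh) (eh _ di)) => t Vt dt; apply: WU; apply/WV.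
(* [A] is cut out by [W] in the chart [i]; in any other chart [j] it is cut out by the pull-back [V]
   of [W]. *)
pose A : set (frame J) := [set f | dom i (fbase f) /\ W (frame_coord i f)].
have oA : frame_open A.
  move=> j; pose V : set (M * 'M[R]_(n + n)) := [set q | dom i q.1 /\ dom j q.1 /\
    W (q.1, q.2 *m change j i q.1)].
  exists V; last first.
    move=> f fj; split=> [[fi]|[fi [_]]].
      by rewrite (frame_coord_change fi fj).
    move=> Wf; split; first exact: fi.
    exact (eq_ind_r W Wf (frame_coord_change fi fj)).
  rewrite openE => q [qi [qj Wq]]; rewrite /interior.
  have FQ : Filter (nbhs q) := nbhs_filter q.
  have c1 : q'.1 @[q' --> nbhs q] --> q.1 by exact: fst_cvg.
  have c2 : q'.2 @[q' --> nbhs q] --> q.2 by exact: snd_cvg.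
  have c3 : change j i q'.1 @[q' --> nbhs q] --> change j i q.1.
    exact: (cvg_comp _ _ c1 (change_cvg qj qi)).
  have c4 := cvg_pair_nbhs FQ c1 (@mulmx_cvg _ _ _ FQ _ _ _ _ _ _ _ c2 c3).
  have nW : nbhs (q.1, q.2 *m change j i q.1) W by apply: open_nbhs_nbhs.
  have ni := c1 _ (near_dom qi); have nj := c1 _ (near_dom qj).
  by apply: (@filterS3 _ _ FQ _ _ _ _ _ ni nj (c4 _ nW)) => q'.
have nA : nbhs h A by apply: open_nbhs_nbhs; split.
by apply: (@filterS _ F FF _ _ _ (eh _ nA)) => t [_ /WU].
Qed.

Lemma fbase_cvg (T : Type) (F : set_system T) (FF : Filter F)
  (e : T -> frame J) h : e @ F --> h -> fbase (e t) @[t --> F] --> fbase h.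
Proof.
move=> /(frame_coord_cvgE FF _ (chart_atP _)) c.
exact: (cvg_comp _ _ c cvg_fst).
Qed.

(** The group acts on the left of the coordinate matrix and chart changes on its right, so the
    action has the same expression in a fixed chart. *)
Lemma frame_act_cvg (T : Type) (F : set_system T) (FF : Filter F)
    (e e' : T -> frame J) (D : T -> 'M[R]_(n + n)) h h' (C : 'M[R]_(n + n)) :
  e @ F --> h -> D @ F --> C -> frame_act h h' C ->
  (\forall t \near F, frame_act (e t) (e' t) (D t)) -> e' @ F --> h'.
Proof.
move=> eh DC [b m] act; set i := chart_at (fbase h).
have di : dom i (fbase h) by exact: chart_atP.
have di' : dom i (fbase h') by rewrite b.
apply/(frame_coord_cvgE FF _ di'); move/(frame_coord_cvgE FF _ di): eh => c.
have c1 : fbase (e t) @[t --> F] --> fbase h by exact: (cvg_comp _ _ c cvg_fst).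
have c2 : (frame_coord i (e t)).2 @[t --> F] --> (frame_coord i h).2.
  exact: (cvg_comp _ _ c cvg_snd).
have actE f f' A : frame_act f f' A ->
    frame_coord i f' = (fbase f, A^T *m (frame_coord i f).2).
  by rewrite /frame_coord => -[-> ->] /=; rewrite mulmxA.
rewrite (actE _ _ _ (conj b m)).
apply: (cvg_near_eq FF _ (cvg_pair_nbhs FF c1 (mulmx_cvg (trmx_cvg DC) c2))).
by apply: filterS act => t /actE ->.
Qed.

(** The chart cancels in the quotient of two frames at one point, so this quotient can converge
    although [fmat] itself need not. *)
Lemma frame_coord_ratio i f h : fbase h = fbase f -> dom i (fbase f) ->
  (frame_coord i h).2 *m invmx (frame_coord i f).2 = fmat h *m invmx (fmat f).
Proof.
move=> b fi; rewrite /= b; have cU := change_unit (chart_atP _) fi.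
set c := change _ _ _ in cU *; have fU := fmat_unit f.
have -> : fmat h *m c = fmat h *m invmx (fmat f) *m (fmat f *m c).
  by rewrite mulmxA mulmxKV.
by rewrite mulmxK// unitmx_mul fU.
Qed.

Lemma frame_ratio_cvg (T : Type) (F : set_system T) (FF : Filter F)
    (e e' : T -> frame J) f h : fbase h = fbase f ->
  (\forall t \near F, fbase (e' t) = fbase (e t)) ->
  e @ F --> f -> e' @ F --> h ->
  fmat (e' t) *m invmx (fmat (e t)) @[t --> F] --> fmat h *m invmx (fmat f).
Proof.
move=> b bt ef eh; set i := chart_at (fbase f).
have fi : dom i (fbase f) by exact: chart_atP.
have hi : dom i (fbase h) by rewrite b.
have di := fbase_cvg FF ef (near_dom fi).
have cU (g : frame J) : dom i (fbase g) -> (frame_coord i g).2 \in unitmx.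
  move=> gi; rewrite /= unitmx_mul fmat_unit/=.
  exact: (change_unit (chart_atP _) gi).
move/(frame_coord_cvgE FF _ fi): ef => cf; move/(frame_coord_cvgE FF _ hi): eh => ch.
have cf2 : (frame_coord i (e t)).2 @[t --> F] --> (frame_coord i f).2.
  exact: (cvg_comp _ _ cf cvg_snd).
have ch2 : (frame_coord i (e' t)).2 @[t --> F] --> (frame_coord i h).2.
  exact: (cvg_comp _ _ ch cvg_snd).
have dU : \forall t \near F, (frame_coord i (e t)).2 \in unitmx.
  by apply: (@filterS _ F FF _ _ _ di) => t /cU.
have cI := @invmx_cvg _ _ _ FF _ _ _ (cU _ fi) dU cf2.
rewrite -(frame_coord_ratio b fi).
apply: (cvg_near_eq FF _ (mulmx_cvg ch2 cI)).
by apply: filterS2 bt di => t bt dt; exact: frame_coord_ratio.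
Qed.

Lemma gclass_cvg (T : Type) (F : set_system T) (FF : Filter F) (e : T -> frame J) f :
  e @ F --> f -> gclass (e t) @[t --> F] --> gclass f.
Proof.
move=> ef U; rewrite nbhsE => -[V [oV Vf] VU].
have nV : nbhs f (@gclass _ _ _ _ J @^-1` V) by apply: open_nbhs_nbhs.
by apply: (@filterS _ F FF _ _ _ (ef _ nV)) => t /VU.
Qed.

(** If [h] is a translate of some [f] in [A], translating back by the same matrix sends the frames
    near [h] into [A]. *)
Lemma gclass_open (A : set (frame J)) : open A -> open (@gclass _ _ _ _ J @` A).
Proof.
move=> oA; suff : open (@gclass _ _ _ _ J @^-1` (@gclass _ _ _ _ J @` A)) by [].
rewrite openE => h [f Af /gclass_eqP[C EC fh]]; have UC := EC.1; rewrite /interior.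
have [UCT CC] := unitary_real_tr UC; have hf := frame_act_sym UC fh.
have [r rP] : exists r : frame J -> frame J, forall k, frame_act k (r k) C^T.
  exists (fun k => projT1 (cid (frame_act_ex k UCT))) => k.
  by case: cid.
have id_h : k @[k --> nbhs h] --> h by [].
have act : \forall k \near nbhs h, frame_act k (r k) C^T.
  by apply: filterE.
have FH : Filter (nbhs h) := nbhs_filter h.
have c : r k @[k --> nbhs h] --> f.
  exact: (frame_act_cvg FH id_h (cvg_cst _) hf act).
have nA : nbhs f A by apply: open_nbhs_nbhs.
apply: (@filterS _ _ FH _ _ _ (c _ nA)) => k Ark; exists (r k) => //.
apply/esym/gclass_eqP; exists C^T; last exact: rP.
apply/(eunitary_sqr UCT); move/(eunitary_sqr UC): EC => C2.
by rewrite -[LHS]mul1r -C2 -exprMn -detCM// (mulmx1C CC) detC1 expr1n.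
Qed.

(** This is how continuity questions on the circle bundle are reduced to frames. *)
Lemma gclass_lift (T : Type) (F : set_system T) (FF : Filter F)
    (e : T -> Gamma J) f (A : set (frame J)) :
  e @ F --> gclass f -> nbhs f A ->
  \forall t \near F, exists2 h, A h & e t = gclass h.
Proof.
move=> ef; rewrite nbhsE => -[B [oB Bf] BA].
have nB : nbhs (gclass f) (@gclass _ _ _ _ J @` B).
  by apply: open_nbhs_nbhs; split; [exact: gclass_open | exists f].
by apply: (@filterS _ F FF _ _ _ (ef _ nB)) => t [h /BA Ah <-]; exists h.
Qed.

Lemma gbase_cvg (T : Type) (F : set_system T) (FF : Filter F)
  (e : T -> Gamma J) x : e @ F --> x -> gbase (e t) @[t --> F] --> gbase x.
Proof.
have [f ->] := gclass_surj x; rewrite gbaseE => ef U nU.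
have id_f : k @[k --> nbhs f] --> f by [].
have := gclass_lift FF ef (fbase_cvg (nbhs_filter f) id_f nU).
by apply: filterS => t [h Uh eh] /=; rewrite eh gbaseE.
Qed.

Definition gdiv x y : circle R := xget (expi 0) [set z | gact x z = y].

Lemma gdivP x y : gbase x = gbase y -> gact x (gdiv x y) = y.
Proof.
move=> b; apply: (@xgetPex _ (expi 0) [set z | gact x z = y]).
have [[f xE] [h yE]] := (gclass_surj x, gclass_surj y).
have [|C UC fh] := @frame_rel _ _ _ _ J f h.
  by rewrite -gbaseE -yE -b xE gbaseE.
have n1 : `|detC C ^+ 2| == 1 by rewrite normrX (norm_detC UC) expr1n.
exists (exist (fun u : R[i] => `|u| == 1) _ n1).
by rewrite /= xE yE; exact: gactE fh.
Qed.

End FrameTopology.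

(** * The principal circle action, its continuity, and trivializations *)

Section CircleBundle.
Context {R : realType} {n : nat} {M : smooth_manifold R (n.+1 + n.+1)}.
Context {om : symplectic_form M} {J : compatible_structure om}.
Implicit Types (p : M) (f h : frame J) (x y : Gamma J) (z w : circle R).

Lemma csqrt z : exists w, circle_mul w w = z.
Proof.
have [t _ <-] := expi_surj z; exists (expi (t / 2)).
by rewrite -expiD -splitr.
Qed.

(** The action is read through the square of [detC], so a square root of [z] goes into
    [circle_mx]. *)
Lemma gact_ex f z : exists C h, [/\ unitary_real C, detC C ^+ 2 = val z,
  frame_act f h C & gact (gclass f) z = gclass h].
Proof.
have [w wz] := csqrt z; have UC := circle_mx_unitary n w.
have [h fh] := frame_act_ex f UC.
have dz : detC (circle_mx n w) ^+ 2 = val z by rewrite detC_circle_mx -wz expr2.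
by exists (circle_mx n w), h; split => //; exact: gactE fh.
Qed.

Lemma gbase_gact x z : gbase (gact x z) = gbase x.
Proof.
have [f ->] := gclass_surj x; have [C [h [_ _ [b _] ->]]] := gact_ex f z.
by rewrite !gbaseE b.
Qed.

Lemma gactM x z w : gact (gact x z) w = gact x (circle_mul z w).
Proof.
have [f ->] := gclass_surj x; have [C [h [UC dC fh ->]]] := gact_ex f z.
have [D [k [UD dD hk ->]]] := gact_ex h w.
apply/esym; apply: (@gactE _ _ _ _ _ _ _ (C *m D)).
- exact: unitary_realM.
- by rewrite detCM// exprMn dC dD.
- exact: frame_act_trans fh hk.
Qed.

Lemma gact1 x : gact x (expi 0) = x.
Proof.
have [f ->] := gclass_surj x; apply: (@gactE _ _ _ _ _ _ _ 1%:M).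
- exact: unitary_real1.
- by rewrite detC1 expr1n /= cos0 sin0.
- exact: frame_act1.
Qed.

(** Both [z] and [w] are squared determinants of transition matrices from [f] to frames of one
    class, and such matrices agree up to EU(n). *)
Lemma gact_free x z w : gact x z = gact x w -> z = w.
Proof.
have [f ->] := gclass_surj x; have [C [h [UC dC fh ->]]] := gact_ex f z.
have [D [k [UD dD fk ->]]] := gact_ex f w.
move=> /gclass_eqP[E EE hk]; apply/val_inj; rewrite -dC -dD.
have UE := EE.1; move/(eunitary_sqr UE): EE => E2.
rewrite -(frame_act_matrix fk) (frame_act_matrix (frame_act_trans fh hk)).
by rewrite detCM// exprMn E2 mulr1.
Qed.

Lemma gdiv_gact x z : gdiv x (gact x z) = z.
Proof. by apply: (@gact_free x); rewrite gdivP// gbase_gact. Qed.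

(** [gdiv] is defined by choice; this formula is what its continuity is read from. *)
Lemma gdiv_frame f h : fbase h = fbase f ->
  val (gdiv (gclass f) (gclass h)) = detC (fmat h *m invmx (fmat f))^T ^+ 2.
Proof.
move=> b; have g : gact (gclass f) (gdiv (gclass f) (gclass h)) = gclass h.
  by apply: gdivP; rewrite !gbaseE.
have [C [k [UC dC fk gk]]] := gact_ex f (gdiv (gclass f) (gclass h)).
rewrite -dC; move: g; rewrite gk => /gclass_eqP[E EE kh].
have UE := EE.1; move/(eunitary_sqr UE): EE => E2.
rewrite (frame_act_matrix (frame_act_trans fk kh)).
by rewrite detCM// exprMn E2 mulr1.
Qed.

Lemma gdiv_cvg (T : Type) (F : set_system T) (FF : Filter F)
    (a b : T -> Gamma J) x y : gbase x = gbase y ->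
  (\forall t \near F, gbase (a t) = gbase (b t)) ->
  a @ F --> x -> b @ F --> y -> gdiv (a t) (b t) @[t --> F] --> gdiv x y.
Proof.
have [[f ->] [h ->]] := (gclass_surj x, gclass_surj y); rewrite !gbaseE => bfh bt af bh.
move=> U nU.
(* Pairs of frames over a common point: the formula for [gdiv] holds only there, whence the filters
   [within S]. *)
pose S : set (frame J * frame J) := [set q | fbase q.2 = fbase q.1].
have FS : Filter (within S (nbhs (f, h))) by exact: within_filter.
have c1 : q.1 @[q --> within S (nbhs (f, h))] --> f.
  by apply: cvg_trans (@fst_cvg _ _ (f, h)); exact: cvg_within_filter.
have c2 : q.2 @[q --> within S (nbhs (f, h))] --> h.
  by apply: cvg_trans (@snd_cvg _ _ (f, h)); exact: cvg_within_filter.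
have nS : \forall q \near within S (nbhs (f, h)), fbase q.2 = fbase q.1.
  exact: withinT.
have c := @trmx_cvg _ _ _ FS _ _ _ _ (frame_ratio_cvg FS (esym bfh) nS c1 c2).
have [cR cI] := @detC_cvg _ _ _ FS _ _ _ c.
have cg : gdiv (gclass q.1) (gclass q.2) @[q --> within S (nbhs (f, h))] -->
    gdiv (gclass f) (gclass h).
  have sqE (u : R[i]) : complex.Re (u ^+ 2) = complex.Re u ^+ 2 - complex.Im u ^+ 2 /\
      complex.Im (u ^+ 2) = 2 * (complex.Re u * complex.Im u).
    by case: u => s t /=; split; ring.
  apply: cre_cvg.
    rewrite {2}/cre gdiv_frame// (sqE _).1.
    apply: (cvg_near_eq FS _ (cvgB (cvgM cR cR) (cvgM cI cI))).
    by apply: filterS nS => q bq; rewrite /cre gdiv_frame// (sqE _).1.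
  rewrite {2}/cim gdiv_frame// (sqE _).2.
  apply: (cvg_near_eq FS _ (cvgM (cvg_cst _) (cvgM cR cI))).
  by apply: filterS nS => q bq; rewrite /cim gdiv_frame// (sqE _).2.
have [[A B] /= [nA nB] AB] := cg _ nU.
have := gclass_lift FF bh nB; have := gclass_lift FF af nA; move: bt.
apply: filterS3 => t bt [f' Af' aE] [h' Bh' bE] /=.
rewrite aE bE; apply: (AB (f', h')) => //.
by move: bt; rewrite /S /= aE bE !gbaseE => ->.
Qed.

Lemma circle_mx_cvg (T : Type) (F : set_system T) (FF : Filter F)
    (u : T -> circle R) z :
  u @ F --> z -> circle_mx n (u t) @[t --> F] --> circle_mx n z.
Proof.
move=> uz; pose d w : 'M[R[i]]_n.+1 := diag_mx (\row_j (if j == 0 then val w else 1)).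
have cd k l : complex.Re (d (u t) k l) @[t --> F] --> complex.Re (d z k l) /\
    complex.Im (d (u t) k l) @[t --> F] --> complex.Im (d z k l).
  split; rewrite !mxE; under eq_fun do rewrite !mxE.
    case: (k == l); last by rewrite mulr0n; exact: cvg_cst.
    case: (k == 0); last by rewrite mulr1n; exact: cvg_cst.
    by rewrite mulr1n; exact: cvg_cre.
  case: (k == l); last by rewrite mulr0n; exact: cvg_cst.
  case: (k == 0); last by rewrite mulr1n; exact: cvg_cst.
  by rewrite mulr1n; exact: cvg_cim.
have cR : remx (d (u t)) @[t --> F] --> remx (d z).
  by apply: mx_cvg => k l; rewrite [X in _ --> X]mxE;
    under eq_fun do rewrite mxE; exact: (cd k l).1.
have cI : immx (d (u t)) @[t --> F] --> immx (d z).
  by apply: mx_cvg => k l; rewrite [X in _ --> X]mxE;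
    under eq_fun do rewrite mxE; exact: (cd k l).2.
have row_cvg (A B : T -> 'M[R]_n.+1) (A0 B0 : 'M[R]_n.+1) : A @ F --> A0 ->
    B @ F --> B0 -> row_mx (A t) (B t) @[t --> F] --> row_mx A0 B0.
  move=> cA cB; rewrite -[row_mx A0 B0]trmxK tr_row_mx.
  under eq_fun do rewrite -[row_mx _ _]trmxK tr_row_mx.
  by apply: trmx_cvg; apply: col_mx_cvg; exact: trmx_cvg.
rewrite /circle_mx /realify /block_mx; apply: col_mx_cvg; apply: row_cvg;
  [exact: cR | exact: oppmx_cvg cI | exact: cI | exact: cR].
Qed.

Lemma gact_cvg (T : Type) (F : set_system T) (FF : Filter F)
    (a : T -> Gamma J) (u : T -> circle R) x z :
  a @ F --> x -> u @ F --> z -> gact (a t) (u t) @[t --> F] --> gact x z.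
Proof.
have [[f ->] [t0 _ <-]] := (gclass_surj x, expi_surj z) => af uz.
pose Q := nbhs (f, expi t0); have FQ : Filter Q := nbhs_filter (f, expi t0).
(* Halving the local logarithm gives a square root that is continuous near [expi t0], hence a
   continuous choice of matrices. *)
pose D w := circle_mx n (expi (log_at t0 w / 2)).
have c1 : q.1 @[q --> Q] --> f by exact: (@fst_cvg _ _ (f, expi t0)).
have c2 : q.2 @[q --> Q] --> expi t0 by exact: (@snd_cvg _ _ (f, expi t0)).
have cD : D q.2 @[q --> Q] --> circle_mx n (expi (t0 / 2)).
  apply: circle_mx_cvg; apply: expi_cvg; apply: cvgM; last exact: cvg_cst.
  exact: log_at_cvg c2.
have [h fh] := frame_act_ex f (circle_mx_unitary n (expi (t0 / 2))).
have [r rP] : exists r : frame J * circle R -> frame J,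
    forall q, frame_act q.1 (r q) (D q.2).
  exists (fun q => projT1 (cid (frame_act_ex q.1
    (circle_mx_unitary n (expi (log_at t0 q.2 / 2)))))) => q.
  by case: cid.
have cr : r q @[q --> Q] --> h.
  by apply: (frame_act_cvg FQ c1 cD fh); exact: filterE.
have detD (w : R) : detC (circle_mx n (expi (w / 2))) ^+ 2 = val (expi w).
  by rewrite detC_circle_mx [in RHS](splitr w) expiD expr2.
have c : gact (gclass q.1) q.2 @[q --> Q] --> gact (gclass f) (expi t0).
  rewrite (gactE (circle_mx_unitary n _) (detD t0) fh).
  apply: (cvg_near_eq FQ _ (gclass_cvg FQ cr)).
  apply: (@filterS _ _ FQ _ _ _ (near_log_atK c2)) => q qE.
  apply/esym; apply: (gactE (circle_mx_unitary n _) _ (rP q)).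
  by rewrite detD qE.
move=> U /c [[A B] /= [nA nB] AB].
by apply: (@filterS2 _ F FF _ _ _ _ (uz _ nB) (gclass_lift FF af nA)) =>
  t Bt [k Ak tk] /=; rewrite tk; exact: (AB (k, u t)).
Qed.

Lemma within_cvg_comp (T : Type) (F : set_system T) (FF : Filter F)
    (U V : topologicalType) (A : set U) (g : U -> V) (a : T -> U) (x : U) :
  {within A, continuous g} -> A x -> (\forall t \near F, A (a t)) ->
  a @ F --> x -> g (a t) @[t --> F] --> g x.
Proof.
move=> /subspace_continuousP cg Ax Aa ax W nW.
apply: (@filterS2 _ F FF _ _ _ _ Aa (ax _ (cg x Ax W nW))) => t At /=; exact.
Qed.

Lemma trivial_overP (Y : set M) :
  trivial_over J Y <-> exists s : M -> Gamma J, section_over Y s.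
Proof.
split=> [[Phi [Psi [cPhi _ PhiP _ _]]]|[s [cs sY]]].
  exists (fun q => Phi (q, expi 0)).
  split=> [|q Yq]; last by have [] := PhiP q (expi 0) Yq.
  apply/subspace_continuousP => q Yq.
  have FY : Filter (within Y (nbhs q)) by exact: within_filter.
  have cid : k @[k --> within Y (nbhs q)] --> q by exact: cvg_within_filter.
  apply: (within_cvg_comp FY cPhi).
  - by split.
  - have : \forall k \near within Y (nbhs q), Y k by exact: withinT.
    by apply: filterS => k Yk; split.
  - by apply: cvg_pair_nbhs => //; exact: cvg_cst.
exists (fun k : M * circle R => gact (s k.1) k.2).
exists (fun x => (gbase x, gdiv (s (gbase x)) x)).
split=> [| |q z Yq|x Yx|q z w Yq] /=.
- apply/subspace_continuousP => -[q z] [/= Yq _].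
  set F := within _ _; have FY : Filter F by exact: within_filter.
  have Fid : k @[k --> F] --> (q, z) by exact: cvg_within_filter.
  have c1 : k.1 @[k --> F] --> q by exact: (cvg_comp _ _ Fid (@fst_cvg _ _ (q, z))).
  have c2 : k.2 @[k --> F] --> z by exact: (cvg_comp _ _ Fid (@snd_cvg _ _ (q, z))).
  apply: gact_cvg => //; apply: (within_cvg_comp FY cs Yq _ c1).
  have : \forall k \near F, (Y `*` setT) k by exact: withinT.
  by apply: filterS => k [].
- apply/subspace_continuousP => x /= Yx.
  set F := within _ _; have FY : Filter F by exact: within_filter.
  have Fid : k @[k --> F] --> x by exact: cvg_within_filter.
  have nY : \forall k \near F, Y (gbase k) by exact: withinT.
  have cb := gbase_cvg FY Fid.
  apply: cvg_pair_nbhs => //; apply: gdiv_cvg => //.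
  + by rewrite sY.
  + by apply: filterS nY => k Yk; rewrite sY.
  + exact: (within_cvg_comp FY cs Yx nY cb).
- by rewrite gbase_gact sY// gdiv_gact.
- by rewrite gdivP// sY.
- by rewrite gactM.
Qed.

End CircleBundle.

(** * The section given by the Lagrangian torus *)

Section GramSchmidt.
Context {R : realType}.
Implicit Types (G : 'M[R]_2) (w : 'rV[R]_2).

(** The squared length of the second vector minus its projection on the first one (a Schur
    complement). *)
Definition gs_coef G : R := G 1 1 - G 0 1 ^+ 2 / G 0 0.

(* The rows of [gs G *m D] are obtained from those of D by the Gram-Schmidt
   process, G being the Gram matrix of D. *)
Definition gs G : 'M[R]_2 := \matrix_(i, j)
  if i == 0 then if j == 0 then (Num.sqrt (G 0 0))^-1 else 0
  else if j == 0 then - (G 0 1 / G 0 0) / Num.sqrt (gs_coef G)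
  else (Num.sqrt (gs_coef G))^-1.

Lemma lift0_ord2 : lift ord0 ord0 = 1 :> 'I_2.
Proof. exact: val_inj. Qed.

Lemma ord2P (i : 'I_2) : i = 0 \/ i = 1.
Proof.
by case: i => [[|[|//]] ?]; [left | right]; exact: val_inj.
Qed.

Lemma sum_ord2 (F : 'I_2 -> R) : \sum_i F i = F 0 + F 1.
Proof. by rewrite !big_ord_recl big_ord0 lift0_ord2 addr0. Qed.

Lemma gs_pos G : G^T = G -> (forall w, w != 0 -> 0 < (w *m G *m w^T) 0 0) ->
  0 < G 0 0 /\ 0 < gs_coef G.
Proof.
move=> GT Gp; have G10 : G 1 0 = G 0 1 by rewrite -[in LHS]GT mxE.
have G00 : 0 < G 0 0.
  have : (delta_mx 0 0 : 'rV[R]_2) != 0.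
    by apply/eqP => /matrixP/(_ 0 0)/eqP; rewrite !mxE !eqxx oner_eq0.
  move/Gp; rewrite -rowE mxE sum_ord2 !mxE.
  by rewrite !eqxx mulr1 mulr0 addr0.
(* Coefficients of the second vector minus its projection on the first one. *)
split=> //; pose w : 'rV[R]_2 := \row_j (if j == 0 then - (G 0 1 / G 0 0) else 1).
have : w != 0 by apply/eqP => /matrixP/(_ 0 1)/eqP; rewrite !mxE oner_eq0.
move/Gp; rewrite mxE sum_ord2 !mxE !sum_ord2 !mxE !eqxx /= G10 /gs_coef.
congr (_ < _); field; exact: lt0r_neq0.
Qed.

Lemma gsP G : G^T = G -> 0 < G 0 0 -> 0 < gs_coef G ->
  gs G *m G *m (gs G)^T = 1%:M.
Proof.
move=> GT a0 d0; have G10 : G 1 0 = G 0 1 by rewrite -[in LHS]GT mxE.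
have sa := sqr_sqrtr (ltW a0); have sd := sqr_sqrtr (ltW d0).
have sa0 : Num.sqrt (G 0 0) != 0 by rewrite lt0r_neq0// sqrtr_gt0.
have sd0 : Num.sqrt (gs_coef G) != 0 by rewrite lt0r_neq0// sqrtr_gt0.
move: sa0 sd0 sa sd; rewrite /gs; move: (Num.sqrt (G 0 0)) (Num.sqrt (gs_coef G)) => x y.
move=> x0 y0 xa yd.
have dE : G 1 1 = y ^+ 2 + G 0 1 ^+ 2 / x ^+ 2 by rewrite yd xa /gs_coef; ring.
apply/matrixP => i j; rewrite !mxE sum_ord2 !mxE !sum_ord2 !mxE /=.
by case: (ord2P i) => ->; case: (ord2P j) => -> /=; rewrite G10 dE -xa; field;
  rewrite ?x0 ?y0.
Qed.

(** Continuity is the reason for explicit formulas: an orthonormal basis chosen arbitrarily at each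
    point would not vary continuously. *)
Lemma gs_cvg (T : Type) (F : set_system T) (FF : Filter F) (H : T -> 'M[R]_2) G :
  0 < G 0 0 -> 0 < gs_coef G -> H @ F --> G -> gs (H t) @[t --> F] --> gs G.
Proof.
move=> a0 d0 HG; have c i j : H t i j @[t --> F] --> G i j by exact: mx_coord_cvg.
have ci : (H t 0 0)^-1 @[t --> F] --> (G 0 0)^-1.
  by apply: cvgV; [exact: lt0r_neq0 | exact: c].
have cd : gs_coef (H t) @[t --> F] --> gs_coef G.
  by apply: cvgB => //; apply: cvgM => //; apply: cvgM.
have cs : (Num.sqrt (gs_coef (H t)))^-1 @[t --> F] --> (Num.sqrt (gs_coef G))^-1.
  apply: cvgV; first by rewrite lt0r_neq0// sqrtr_gt0.
  exact: (cvg_comp _ _ cd (@sqrt_continuous R _)).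
have ca : (Num.sqrt (H t 0 0))^-1 @[t --> F] --> (Num.sqrt (G 0 0))^-1.
  apply: cvgV; first by rewrite lt0r_neq0// sqrtr_gt0.
  exact: (cvg_comp _ _ (c 0 0) (@sqrt_continuous R _)).
apply: mx_cvg => i j; rewrite !mxE; under eq_fun do rewrite !mxE.
case: (i == 0); case: (j == 0) => //; first exact: cvg_cst.
by apply: cvgM => //; apply: cvgN; apply: cvgM.
Qed.

End GramSchmidt.

(** * The symplectic form and J in a fixed chart *)

Section ChartFields.
Context {R : realType} {m : nat} {M : smooth_manifold R m}.
Context {om : symplectic_form M} {J : compatible_structure om}.
Implicit Types (p q : M) (i : chart_ix M).

(** The matrices of [form_in], indexed by points of the manifold instead of coordinates, so that
    limits are taken along the manifold; [J_in] does the same for [endo_in]. *)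
Definition om_in i q : 'M[R]_m :=
  change i (chart_at q) q *m om q *m (change i (chart_at q) q)^T.

Definition J_in i q : 'M[R]_m :=
  change i (chart_at q) q *m J q *m change (chart_at q) i q.

Lemma field_in_cvg (K : 'rV[R]_m -> 'M[R]_m) (L : M -> 'M[R]_m) i p :
  dom i p -> smooth_on (chart i @` dom i) K ->
  (forall q, dom i q -> K (chart i q) = L q) -> L q @[q --> p] --> L p.
Proof.
move=> ip sK KL; rewrite -(KL p ip).
have cK : K x @[x --> chart i p] --> K (chart i p).
  by apply: (smooth_continuous sK); exists p.
have FP : Filter (nbhs p) := nbhs_filter p.
apply: (cvg_near_eq FP _ (cvg_comp _ _ (chart_cvg ip) cK)).
by apply: (@filterS _ _ FP _ _ _ (near_dom ip)) => q /KL.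
Qed.

Lemma om_in_cvg i p : dom i p -> om_in i q @[q --> p] --> om_in i p.
Proof.
move=> ip; apply: (field_in_cvg ip (omega_smooth om i)) => q iq.
exact (congr1 (fun r => change i (chart_at r) r *m om r *m (change i (chart_at r) r)^T)
  (chartK iq)).
Qed.

Lemma J_in_cvg i p : dom i p -> J_in i q @[q --> p] --> J_in i p.
Proof.
move=> ip; apply: (field_in_cvg ip (acs_smooth J i)) => q iq.
exact (congr1 (fun r => change i (chart_at r) r *m J r *m change (chart_at r) i r)
  (chartK iq)).
Qed.

Lemma change_at_inv i q : dom i q ->
  change (chart_at q) i q *m change i (chart_at q) q = 1%:M.
Proof.
move=> iq; have aq := chart_atP q.
exact (etrans (changeM aq iq aq) (change1 aq)).
Qed.

Lemma om_inE i q k l (D : 'M[R]_(k, m)) (E : 'M[R]_(l, m)) : dom i q ->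
  D *m change (chart_at q) i q *m om_in i q *m (E *m change (chart_at q) i q)^T =
  D *m om q *m E^T.
Proof.
move=> iq; rewrite /om_in; have := change_at_inv iq.
move: (change _ i q) (change i _ q) => c d cd.
rewrite trmx_mul -!mulmxA (mulmxA d^T) -trmx_mul cd trmx1 mul1mx.
by rewrite (mulmxA c) cd mul1mx.
Qed.

Lemma J_inE i q k (D : 'M[R]_(k, m)) : dom i q ->
  D *m change (chart_at q) i q *m J_in i q = D *m J q *m change (chart_at q) i q.
Proof.
move=> iq; rewrite /J_in; have := change_at_inv iq.
move: (change _ i q) (change i _ q) => c d cd.
by rewrite -!mulmxA (mulmxA c) cd mul1mx.
Qed.

End ChartFields.

(** * Polar coordinates on the cylinder *)

Section PolarCoordinates.
Context {R : realType}.
Implicit Types (x : 'rV[R]_2) (y : circle R * R).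

Lemma polar_surj y : exists x, polar x = y.
Proof.
case: y => z t; have [s _ sz] := expi_surj z.
by exists (\row_j (if j == 0 then s else t)); rewrite /polar !mxE /= sz.
Qed.

Lemma polar_cvg x : polar x' @[x' --> x] --> polar x.
Proof.
have FX : Filter (nbhs x) := nbhs_filter x.
have c j : k 0 j @[k --> nbhs x] --> x 0 j by exact: coord_continuous.
exact: (cvg_pair_nbhs FX (expi_cvg (c 0)) (c 1)).
Qed.

(** [polar] is open: near [polar x] it has the continuous local section [L], given by the branch of
    the logarithm at the angle of [x]. *)
Lemma polar_nbhs x (A : set (circle R * R)) :
  nbhs x (@polar R @^-1` A) -> nbhs (polar x) A.
Proof.
move=> nA; pose L y : 'rV[R]_2 := \row_j (if j == 0 then log_at (x 0 0) y.1 else y.2).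
have FP : Filter (nbhs (polar x)) := nbhs_filter (polar x).
have c1 : y.1 @[y --> nbhs (polar x)] --> expi (x 0 0) by exact: (@fst_cvg _ _ (polar x)).
have c2 : y.2 @[y --> nbhs (polar x)] --> x 0 1 by exact: (@snd_cvg _ _ (polar x)).
have cL : L y @[y --> nbhs (polar x)] --> x.
  apply: mx_cvg => i j; under eq_fun do rewrite mxE.
  rewrite (ord1 i); case: (ord2P j) => -> /=; last exact: c2.
  exact: log_at_cvg c1.
have nL := @near_log_atK _ _ _ FP _ _ c1.
by apply: (@filterS2 _ _ FP _ _ _ _ (cL _ nA) nL) => -[z t] /= Az ez; move: Az; rewrite /polar !mxE /= ez.
Qed.

Lemma polar_inj x x' : polar x = polar x' ->
  exists k : int, x' = x + \row_j (if j == 0 then 2 * pi * k%:~R else 0).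
Proof.
move=> e; have e0 : expi (x 0 0) = expi (x' 0 0) := congr1 fst e.
have e1 : x 0 1 = x' 0 1 := congr1 snd e.
have [k ek] := expi_inj (esym e0); exists k.
apply/rowP => j; rewrite !mxE; case: (ord2P j) => -> /=; first exact: ek.
by rewrite addr0 e1.
Qed.

Lemma near_open_cylinder y : open_cylinder R y ->
  \forall y' \near y, open_cylinder R y'.
Proof.
move=> oy; have nI : nbhs y.2 `]-1, 1[%classic.
  by apply: open_nbhs_nbhs; split; [exact: interval_open | rewrite /= in_itv].
apply: (@filterS _ _ (nbhs_filter y) _ _ _ (@snd_cvg _ _ y _ nI)) => y'.
by rewrite /= in_itv.
Qed.

Lemma open_closed_cylinder : open_cylinder R `<=` closed_cylinder R.
Proof. by move=> y /andP[/ltW y1 /ltW y2]; rewrite /closed_cylinder /= y1. Qed.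

Lemma derive_translate m (W : normedModType R) (g : 'rV[R]_m -> W) v :
  (forall u, g (u + v) = g u) -> forall w (x : 'rV[R]_m), 'D_w g (x + v) = 'D_w g x.
Proof.
move=> gv w x; rewrite /derive gv.
suff -> : g \o shift (x + v) = g \o shift x by [].
by apply/funext => y /=; rewrite addrA gv.
Qed.

End PolarCoordinates.

(** * Unitary frames along the Lagrangian torus, and descent to the pinched torus *)

Section LagrangianFrames.
Context {R : realType} {M : smooth_manifold R (2 + 2)}.
Context {om : symplectic_form M} {J : compatible_structure om}.
Context {P : circle R * R -> M} (hP : lagrangian_pinched_torus om P).
Implicit Types (x : 'rV[R]_2) (y : circle R * R) (i : chart_ix M).

Lemma torus_continuous : {within closed_cylinder R, continuous P}.
Proof. by case: hP. Qed.

Lemma torus_cvg y : open_cylinder R y -> P y' @[y' --> y] --> P y.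
Proof.
move=> oy; have FY : Filter (nbhs y) := nbhs_filter y.
apply: (within_cvg_comp FY torus_continuous (open_closed_cylinder oy)).
  by apply: (@filterS _ _ FY _ _ _ (near_open_cylinder oy)) => ?; exact: open_closed_cylinder.
exact: cvg_id.
Qed.

Lemma torus_polar_cvg x : open_cylinder R (polar x) ->
  P (polar x') @[x' --> x] --> P (polar x).
Proof. by move=> ox; exact: (cvg_comp _ _ (@polar_cvg _ x) (torus_cvg ox)). Qed.

Definition torus_in i : 'rV[R]_2 -> 'rV[R]_(2 + 2) := chart i \o P \o @polar R.

Definition torus_dom i : set 'rV[R]_2 :=
  [set x | open_cylinder R (polar x) /\ dom i (P (polar x))].

Lemma torus_dom_open i : open (torus_dom i).
Proof.
rewrite openE => x [ox ix]; rewrite /interior.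
apply: (@filterS2 _ _ (nbhs_filter x) _ _ _ _ (polar_cvg (near_open_cylinder ox))
  (torus_polar_cvg ox (near_dom ix))) => x' ? ?.
by split.
Qed.

Lemma torus_in_smooth i : smooth_on (torus_dom i) (torus_in i).
Proof. by case: hP => _ [sm _ _ _] _; exact: sm. Qed.

Lemma torus_in_differentiable i x : torus_dom i x -> differentiable (torus_in i) x.
Proof. exact: smooth_differentiable (@torus_in_smooth i). Qed.

Lemma torus_dom_at x : open_cylinder R (polar x) ->
  torus_dom (chart_at (P (polar x))) x.
Proof. by move=> ox; split=> //; exact: chart_atP. Qed.

(** [dP] is taken in the chart at the image point, which may jump with [x]; this passes to a fixed
    chart, where the Jacobian is continuous. *)
Lemma jacobian_torus_in i x : torus_dom i x -> jacobian (torus_in i) x =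
  dP P x *m change (chart_at (P (polar x))) i (P (polar x)).
Proof.
move=> ix; have jx := torus_dom_at ix.1; set j := chart_at _ in jx *.
have d1 := torus_in_differentiable jx.
have d2 : differentiable (chart i \o chart_inv j) (torus_in j x).
  exact: (transition_differentiable jx.2 ix.2).
have nj : \forall x' \near x, torus_dom j x'.
  by apply: open_nbhs_nbhs; split; [exact: torus_dom_open|].
have e : \forall x' \near x, torus_in i x' =
    ((chart i \o chart_inv j) \o torus_in j) x'.
  apply: (@filterS _ _ (nbhs_filter x) _ _ _ nj) => x' [_ jx'].
  by rewrite /torus_in /= (chartK jx').
exact (etrans (jacobian_near_eq (torus_in_differentiable ix)
  (differentiable_comp d1 d2) e) (jacobian_comp d1 d2)).
Qed.

(** The two preimages differ by a period of the angle, under which [torus_in] is invariant. *)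
Lemma dP_polar x x' : open_cylinder R (polar x) -> polar x = polar x' ->
  dP P x = dP P x'.
Proof.
move=> ox pe; set j := chart_at (P (polar x)).
have jx : torus_dom j x by exact: torus_dom_at.
have jx' : torus_dom j x' by move: jx; rewrite /torus_dom /= pe.
have e' : dP P x' = jacobian (torus_in j) x' by rewrite /dP -pe.
have [k xk] := polar_inj pe.
apply: etrans (esym e'); apply/row_matrixP => a.
apply: etrans (row_jacobian a (torus_in_differentiable jx)) _.
apply: etrans (esym (row_jacobian a (torus_in_differentiable jx'))).
rewrite xk; apply/esym/derive_translate => w.
rewrite /torus_in /= /polar !mxE /= addr0.
by rewrite expi_periodic.
Qed.

Lemma jacobian_torus_cvg i x : torus_dom i x ->
  jacobian (torus_in i) x' @[x' --> x] --> jacobian (torus_in i) x.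
Proof.
move=> ix; exact (smooth_jacobian_cvg (@torus_dom_open i) (@torus_in_smooth i) ix).
Qed.

Definition torus_gram x : 'M[R]_2 :=
  dP P x *m gJ om J (P (polar x)) *m (dP P x)^T.

Definition torus_u x : 'M[R]_(2, 2 + 2) := gs (torus_gram x) *m dP P x.

(** [P] is an immersion on the open cylinder, so the pulled-back metric is positive definite. *)
Lemma torus_gramP x : open_cylinder R (polar x) ->
  (torus_gram x)^T = torus_gram x /\
  0 < torus_gram x 0 0 /\ 0 < gs_coef (torus_gram x).
Proof.
move=> ox; have GT : (torus_gram x)^T = torus_gram x.
  rewrite /torus_gram; have := acs_sym J (P (polar x)).
  by move: (gJ _ _ _) => g gT; rewrite !trmx_mul trmxK gT mulmxA.
split=> //; apply: gs_pos => // w w0.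
have -> : w *m torus_gram x *m w^T =
    (w *m dP P x) *m gJ om J (P (polar x)) *m (w *m dP P x)^T.
  by rewrite /torus_gram trmx_mul !mulmxA.
apply: acs_pos; case: hP => _ [_ rk _ _] _.
have rf : row_free (dP P x) by apply/eqP; exact: rk.
by apply: contra w0 => /eqP; rewrite -(mul0mx _ (dP P x)) => /(row_free_inj rf) ->.
Qed.

Lemma torus_u_unitary x : open_cylinder R (polar x) ->
  is_unitary_frame J (P (polar x)) (col_mx (torus_u x) (- (torus_u x *m J (P (polar x))))).
Proof.
move=> ox; have [GT [G0 Gc]] := torus_gramP ox; apply: frame_of_lagrangian.
  rewrite -(gsP GT G0 Gc) /torus_u; move: (gs _) => g; rewrite /torus_gram.
  by rewrite trmx_mul !mulmxA.
rewrite /torus_u; move: (gs _) => g; case: hP => _ [_ _ _ lag] _.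
transitivity (g *m (dP P x *m om (P (polar x)) *m (dP P x)^T) *m g^T).
  by rewrite trmx_mul !mulmxA.
by rewrite (lag _ ox) mulmx0 mul0mx.
Qed.

Definition is_torus_frame x (f : frame J) := fbase f = P (polar x) /\
  fmat f = col_mx (torus_u x) (- (torus_u x *m J (P (polar x)))).

Lemma torus_frame_ex x : open_cylinder R (polar x) -> exists f, is_torus_frame x f.
Proof. by move=> ox; exists (mkframe (torus_u_unitary ox)). Qed.

(** The map [e] from the quotient is injective, so the fibres of [P] are the classes of
    [pinch_rel]. *)
Lemma torus_eq y y' : closed_cylinder R y -> closed_cylinder R y' ->
  P y = P y' <-> y = y' \/ `|y.2| = 1 /\ `|y'.2| = 1.
Proof.
move=> cy cy'; case: hP => _ _ [e [_ einj _] eE].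
pose c u (h : closed_cylinder R u) : closed_cylinder R := exist _ u (mem_set h).
have cE u (h : closed_cylinder R u) :
    P u = e (\pi_(pinched_cylinder R) (c u h))%qT by rewrite -eE.
rewrite (cE _ cy) (cE _ cy').
have piE : (\pi_(pinched_cylinder R) (c y cy))%qT = (\pi_(pinched_cylinder R) (c y' cy'))%qT <->
    pinch_rel (c y cy) (c y' cy').
  have := eqmodP (pinch_equiv R) (c y cy) (c y' cy').
  by move=> r; split=> /r.
split=> [/einj/piE|h]; last first.
  congr e; apply/piE; rewrite /pinch_rel; case: h => [yy|[-> ->]].
    by apply/orP; left; apply/eqP/val_inj.
  by rewrite eqxx orbT.
by case/orP => [/eqP/(congr1 val)/=|/andP[/eqP ? /eqP ?]]; [left | right].
Qed.

Lemma torus_inj y y' : open_cylinder R y -> open_cylinder R y' ->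
  P y = P y' -> y = y'.
Proof.
move=> oy oy' /(torus_eq (open_closed_cylinder oy) (open_closed_cylinder oy')).
case=> // -[y1 _]; move: oy; rewrite /open_cylinder /= => /andP[y2 y3].
have : `|y.2| < 1 by rewrite ltr_norml y2.
by rewrite y1 ltxx.
Qed.

(** [tangent_o] ranges over all preimages of the point; injectivity of [P] and periodicity of [dP]
    reduce them to [x], and [gs] is invertible. *)
Lemma torus_frame_span x f : open_cylinder R (polar x) -> is_torus_frame x f ->
  frame_span f = tangent_o P (P (polar x)).
Proof.
move=> ox [_ fE]; have [GT [G0 Gc]] := torus_gramP ox.
have gU : gs (torus_gram x) \in unitmx.
  by have := gsP GT G0 Gc; rewrite -mulmxA => /mulmx1_unit[].
have uE : usubmx (fmat f) = gs (torus_gram x) *m dP P x.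
  exact (etrans (congr1 usubmx fE) (col_mxKu _ _)).
apply/seteqP; split=> [v [c ->]|v [x' [c [ox' px' ->]]]].
  by exists x, (c *m gs (torus_gram x)); rewrite uE mulmxA.
exists (c *m invmx (gs (torus_gram x))).
rewrite uE mulmxA (mulmxKV gU).
exact (congr1 (mulmx c) (esym (dP_polar ox (torus_inj ox ox' (esym px'))))).
Qed.

(** Everything is rewritten in the chart at [P (polar x)], where the Jacobian, [om] and [J] are
    continuous, and Gram-Schmidt keeps continuity. *)
Lemma torus_frame_cvg x (e : 'rV[R]_2 -> frame J) : open_cylinder R (polar x) ->
  (forall x', open_cylinder R (polar x') -> is_torus_frame x' (e x')) ->
  e x' @[x' --> x] --> e x.
Proof.
move=> ox eP; have FX : Filter (nbhs x) := nbhs_filter x.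
set i := chart_at (P (polar x)); have ix : torus_dom i x by exact: torus_dom_at.
have nx : \forall x' \near x, torus_dom i x'.
  by apply: open_nbhs_nbhs; split; [exact: torus_dom_open|].
pose D x' := jacobian (torus_in i) x'.
pose Oi x' := om_in (om := om) i (P (polar x')).
pose Ji x' := J_in (J := J) i (P (polar x')).
pose G x' := D x' *m (Ji x' *m Oi x') *m (D x')^T.
have cD : D x' @[x' --> nbhs x] --> D x by exact: jacobian_torus_cvg.
have cO : Oi x' @[x' --> nbhs x] --> Oi x.
  exact: (cvg_comp _ _ (torus_polar_cvg ox) (om_in_cvg ix.2)).
have cJ : Ji x' @[x' --> nbhs x] --> Ji x.
  exact: (cvg_comp _ _ (torus_polar_cvg ox) (J_in_cvg ix.2)).
have GE x' : torus_dom i x' -> torus_gram x' = G x'.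
  move=> ix'; rewrite /G /D (jacobian_torus_in ix') mulmxA.
  rewrite (J_inE _ ix'.2).
  apply: etrans (esym (om_inE (dP P x' *m J (P (polar x'))) (dP P x') ix'.2)).
  by rewrite /torus_gram /gJ mulmxA.
have cG : G x' @[x' --> nbhs x] --> G x.
  apply: mulmx_cvg; last exact: trmx_cvg.
  exact: mulmx_cvg cD (mulmx_cvg cJ cO).
have [_ [G0 Gc]] := torus_gramP ox; rewrite (GE _ ix) in G0 Gc.
have cg : gs (G x') @[x' --> nbhs x] --> gs (G x) by exact: gs_cvg.
have coordE x' : torus_dom i x' -> frame_coord i (e x') =
    (P (polar x'), col_mx (gs (G x') *m D x') (- (gs (G x') *m D x' *m Ji x'))).
  move=> ix'; have [b m] := eP _ ix'.1.
  rewrite /frame_coord b m /torus_u (GE _ ix') mul_col_mx /D (jacobian_torus_in ix').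
  move: (gs _) => g; rewrite mulNmx mulmxA; congr (_, col_mx _ (- _)).
  exact (esym (@J_inE _ _ _ _ J i _ _ (g *m dP P x') ix'.2)).
have bi : dom i (fbase (e x)) by have [-> _] := eP _ ox; exact: ix.2.
apply/(frame_coord_cvgE FX _ bi); rewrite (coordE _ ix).
have cu := @mulmx_cvg _ _ _ FX _ _ _ _ _ _ _ cg cD.
have cv := @oppmx_cvg _ _ _ FX _ _ _ _ (@mulmx_cvg _ _ _ FX _ _ _ _ _ _ _ cu cJ).
have c2 := @col_mx_cvg _ _ _ FX _ _ _ _ _ _ _ cu cv.
apply: (cvg_near_eq FX _ (cvg_pair_nbhs FX (torus_polar_cvg ox) c2)).
by apply: (@filterS _ _ FX _ _ _ nx) => x' ix'; rewrite coordE.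
Qed.

(** [detJ2] is a set of frames; this is the point of the bundle that it represents. The default [g0]
    can occur only off the open cylinder. *)
Definition torus_section (g0 : Gamma J) y : Gamma J :=
  xget g0 [set g | val g = detJ2 (J := J) (P y) (tangent_o P (P y))].

Lemma torus_sectionE g0 x f : open_cylinder R (polar x) -> is_torus_frame x f ->
  torus_section g0 (polar x) = gclass f /\
  detJ2 (P (polar x)) (tangent_o P (P (polar x))) = val (gclass f).
Proof.
move=> ox tf; have dE : detJ2 (P (polar x)) (tangent_o P (P (polar x))) = val (gclass f).
  have fs := torus_frame_span ox tf; have [b _] := tf.
  apply/seteqP; split=> [h [f' [b' fs' f'h]]|h fh].
    have -> : gclass f = gclass f'.
      by apply: frame_span_inj; [rewrite b b' | rewrite fs fs'].
    exact: f'h.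
  by exists f.
split=> //; apply/val_inj; rewrite -dE.
by apply: (@xgetPex _ g0 [set g | val g = detJ2 (P (polar x)) _]); exists (gclass f).
Qed.

Lemma val_torus_section g0 y : open_cylinder R y ->
  val (torus_section g0 y) = detJ2 (P y) (tangent_o P (P y)).
Proof.
have [x <-] := polar_surj y => ox; have [f tf] := torus_frame_ex ox.
by have [-> ->] := torus_sectionE g0 ox tf.
Qed.

Lemma gbase_torus_section g0 y : open_cylinder R y -> gbase (torus_section g0 y) = P y.
Proof.
have [x <-] := polar_surj y => ox; have [f tf] := torus_frame_ex ox.
by have [-> _] := torus_sectionE g0 ox tf; rewrite gbaseE; case: tf.
Qed.

(** As [polar] is open, continuity may be checked on the plane, where [dP] and the frames built from
    it live. *)
Lemma torus_section_cvg g0 y : open_cylinder R y ->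
  torus_section g0 y' @[y' --> y] --> torus_section g0 y.
Proof.
have [x <-] := polar_surj y => ox U nU; apply: polar_nbhs.
have [f0 _] := gclass_surj g0.
have [e eP] : exists e : 'rV[R]_2 -> frame J, forall x', open_cylinder R (polar x') ->
    is_torus_frame x' (e x').
  exists (fun x' => xget f0 [set f | is_torus_frame x' f]) => x' ox'.
  by apply: (@xgetPex _ f0 [set f | is_torus_frame x' f]); exact: torus_frame_ex.
have FX : Filter (nbhs x) := nbhs_filter x.
have ce := gclass_cvg FX (torus_frame_cvg ox eP).
rewrite (torus_sectionE g0 ox (eP _ ox)).1 in nU.
apply: (@filterS2 _ _ FX _ _ _ _ (polar_cvg (near_open_cylinder ox)) (ce _ nU)).
by move=> x' ox' /=; rewrite (torus_sectionE g0 ox' (eP _ ox')).1.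
Qed.

(* As the pinched cylinder is embedded in M, obar carries the quotient topology
   of the closed cylinder. *)
Lemma torus_descend (V : topologicalType) (f : circle R * R -> V) (h : M -> V) :
  {within closed_cylinder R, continuous f} ->
  (forall y, closed_cylinder R y -> h (P y) = f y) ->
  {within obar P, continuous h}.
Proof.
move=> cf hf; case: hP => _ _ [e [_ einj eopen] eE].
apply/subspace_continuousP => _ [y0 cy0 <-] U.
rewrite /from_subspace /= (hf _ cy0) nbhsE => -[W [oW Wy0] WU].
pose O : set (closed_cylinder R) := [set k | W (f (val k))].
pose pic (k : closed_cylinder R) : pinched_cylinder R := (\pi_(pinched_cylinder R) k)%qT.
pose O' := pic @` O.
have cval (y : closed_cylinder R) : closed_cylinder R (val y).
  exact: (set_mem (valP y)).
have oO : open O.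
  rewrite openE => y Oy; rewrite /interior.
  have FY : Filter (nbhs y) := nbhs_filter y.
  have vc : val y' @[y' --> nbhs y] --> val y by exact: initial_continuous.
  have nc : \forall y' \near y, closed_cylinder R (val y') by exact: filterE.
  have := within_cvg_comp FY cf (cval y) nc vc; apply.
  by apply: open_nbhs_nbhs.
(* [O] is saturated because [f] factors through [P] as [h]. *)
have piO : pic @^-1` O' = O.
  apply/seteqP; split=> [y [y' Oy' pe]|y Oy]; last by exists y.
  move: Oy'; rewrite /O /= -(hf _ (cval y')) -(hf _ (cval y)) !eE.
  by rewrite -/(pic y) -/(pic y') pe.
have oO' : open O' by rewrite /open /= /quotient_topology.quotient_open piO.
have [N oN NE] := eopen _ oO'.
have NP (y : closed_cylinder R) : N (P (val y)) <-> O y.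
  by rewrite -piO eE -NE.
pose y0' : closed_cylinder R := exist _ y0 (mem_set cy0).
have nN : nbhs (P y0) N by apply: open_nbhs_nbhs; split => //; exact: ((NP y0').2 Wy0).
rewrite /= /within /=; apply: filterS nN => q Nq [y cy yq].
pose y' : closed_cylinder R := exist _ y (mem_set cy).
have /(NP y')/WU : N (P (val y')) by rewrite /= yq.
by rewrite /= -yq hf.
Qed.

End LagrangianFrames.

(** * The comparison with the Maslov indices *)

Section MaslovTrivialization.
Context {R : realType} {M : smooth_manifold R (2 + 2)}.
Context {om : symplectic_form M} {J : compatible_structure om}.
Context {P : circle R * R -> M} (hP : lagrangian_pinched_torus om P).
Context {B : set M} {a : R} (ha : 0 < a < 1).
Context (hPB : P @` [set x | a <= x.2 <= 1 \/ -1 <= x.2 <= - a] `<=` B).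
Context {s : M -> Gamma J} (hs : section_over B s) (g0 : Gamma J).
Implicit Types (y : circle R * R) (z : circle R) (t : R).

Let sec := torus_section (P := P) g0.
Let g y : circle R := gdiv (s (P y)) (sec y).

Definition collar : set (circle R * R) :=
  [set y | a <= y.2 <= 1 \/ -1 <= y.2 <= - a].

Lemma collar_closed_cylinder : collar `<=` closed_cylinder R.
Proof.
have /andP[a0 a1] := ha; move=> y [] /andP[h1 h2]; apply/andP; split => //.
  by apply: le_trans h1; lra.
by apply: le_trans h2 _; lra.
Qed.

Lemma collar_a z : collar (z, a).
Proof. by have /andP[_ /ltW a1] := ha; left; rewrite /= lexx. Qed.

Lemma collar_ma z : collar (z, - a).
Proof. by have /andP[_ /ltW a1] := ha; right; rewrite /= lexx lerN2 a1. Qed.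

Lemma open_a z : open_cylinder R (z, a).
Proof. by have /andP[? ?] := ha; apply/andP; split => /=; lra. Qed.

Lemma open_ma z : open_cylinder R (z, - a).
Proof. by have /andP[? ?] := ha; apply/andP; split => /=; lra. Qed.

Lemma collarB y : collar y -> B (P y).
Proof. by move=> cy; apply: hPB; exists y. Qed.

Lemma torus_filter_cvg (T : Type) (F : set_system T) (FF : Filter F)
    (e : T -> circle R * R) y : closed_cylinder R y ->
  (\forall t \near F, closed_cylinder R (e t)) -> e @ F --> y ->
  P (e t) @[t --> F] --> P y.
Proof.
move=> cy ce ey; exact: (within_cvg_comp FF (torus_continuous hP) cy ce ey).
Qed.

Lemma collar_section_cvg (T : Type) (F : set_system T) (FF : Filter F)
    (e : T -> circle R * R) y : collar y ->
  (\forall t \near F, collar (e t)) -> e @ F --> y ->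
  s (P (e t)) @[t --> F] --> s (P y).
Proof.
move=> cy ce ey; apply: (within_cvg_comp FF hs.1 (collarB cy)).
  by apply: (@filterS _ F FF _ _ _ ce) => t; exact: collarB.
apply: torus_filter_cvg => //; first exact: collar_closed_cylinder.
by apply: (@filterS _ F FF _ _ _ ce) => t; exact: collar_closed_cylinder.
Qed.

Lemma gbase_collar y : collar y -> gbase (s (P y)) = P y.
Proof. by move=> cy; apply: hs.2; exact: collarB. Qed.

Lemma gact_g y : collar y -> open_cylinder R y -> gact (s (P y)) (g y) = sec y.
Proof.
by move=> cy oy; apply: gdivP; rewrite gbase_collar// gbase_torus_section.
Qed.

(** [triv_coord] and [gdiv] choose from the same set once [detJ2] is replaced by the point it
    represents. *)
Lemma maslov_indexE b : open_cylinder R (expi 0, b) ->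
  maslov_index s (fun z => P (z, b)) (tangent_o P) = degree (fun z => g (z, b)).
Proof.
move=> ob; congr degree; apply/funext => z.
have oz : open_cylinder R (z, b) by [].
rewrite -(val_torus_section hP g0 oz) /triv_coord /g /gdiv; congr (xget _ _).
by apply/seteqP; split=> w /= => [/val_inj|->].
Qed.

Lemma g_continuous b : open_cylinder R (expi 0, b) -> (forall z, collar (z, b)) ->
  continuous (fun z => g (z, b)).
Proof.
move=> ob cb z; have oz w : open_cylinder R (w, b) by [].
have FZ : Filter (nbhs z) := nbhs_filter z.
have cz : (w, b) @[w --> nbhs z] --> (z, b).
  by apply: cvg_pair_nbhs; [exact: cvg_id | exact: cvg_cst].
apply: (gdiv_cvg FZ).
- by rewrite gbase_collar// gbase_torus_section.
- by apply: filterE => w; rewrite gbase_collar// gbase_torus_section.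
- apply: (collar_section_cvg FZ (cb z) _ cz); exact: filterE.
- exact: (cvg_comp _ _ cz (torus_section_cvg hP (oz z))).
Qed.

Lemma clamp_pair_cvg (b c : R) (y : circle R * R) :
  (y'.1, clamp b c y'.2) @[y' --> y] --> (y.1, clamp b c y.2).
Proof.
have FY : Filter (nbhs y) := nbhs_filter y.
have c1 : y'.1 @[y' --> nbhs y] --> y.1 by exact: fst_cvg.
have c2 : clamp b c y'.2 @[y' --> nbhs y] --> clamp b c y.2.
  exact: (cvg_comp _ _ (@snd_cvg _ _ y) (@clamp_continuous R b c _)).
exact: (cvg_pair_nbhs FY c1 c2).
Qed.

Lemma maslov_of_trivial (tau : M -> Gamma J) : section_over (obar P) tau ->
  csim (fun z => g (z, a)) (fun z => g (z, - a)).
Proof.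
move=> [ctau btau]; have /andP[a0 a1] := ha.
have oP y : closed_cylinder R y -> obar P (P y) by move=> cy; exists y.
have tau_cvg (T : Type) (F : set_system T) (FF : Filter F) (e : T -> circle R * R) y :
    closed_cylinder R y -> (\forall t \near F, closed_cylinder R (e t)) -> e @ F --> y ->
    tau (P (e t)) @[t --> F] --> tau (P y).
  move=> cy ce ey; apply: (within_cvg_comp FF ctau (oP _ cy)).
    by apply: (@filterS _ F FF _ _ _ ce) => t; exact: oP.
  exact: torus_filter_cvg.
pose k y := gdiv (tau (P y)) (sec y); pose l y := gdiv (tau (P y)) (s (P y)).
have klg y : collar y -> open_cylinder R y -> k y = circle_mul (l y) (g y).
  move=> cy oy; have cc := collar_closed_cylinder cy.
  apply: (@gact_free _ _ _ _ _ (tau (P y))).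
  rewrite -gactM gdivP; last by rewrite btau ?gbase_torus_section//; exact: oP.
  rewrite gdivP; last by rewrite btau ?gbase_collar//; exact: oP.
  by rewrite gact_g.
(* [homotopic_csim] asks for a homotopy on the whole cylinder; clamping the height provides one from
   a band inside a collar. *)
have l_csim (b c : R) : b <= c -> (forall z t, b <= t <= c -> collar (z, t)) ->
    forall t t', b <= t <= c -> b <= t' <= c ->
    csim (fun z => l (z, t)) (fun z => l (z, t')).
  move=> bc col t t' tI t'I.
  have cL : continuous (fun y => l (y.1, clamp b c y.2)).
    move=> y; have FY : Filter (nbhs y) := nbhs_filter y.
    have cy y' : collar (y'.1, clamp b c y'.2) by apply: col; exact: clamp_itv.
    apply: (gdiv_cvg FY).
    - by rewrite btau ?gbase_collar//; apply/oP/collar_closed_cylinder.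
    - apply: filterE => y'.
      by rewrite btau ?gbase_collar//; apply/oP/collar_closed_cylinder.
    - apply: (tau_cvg _ _ FY _ _ _ _ (@clamp_pair_cvg b c y)).
        exact: collar_closed_cylinder.
      by apply: filterE => y'; exact: collar_closed_cylinder.
    - apply: (collar_section_cvg FY (cy y) _ (@clamp_pair_cvg b c y)).
      exact: filterE.
  have [phi cphi phiE] := homotopic_csim t t' cL.
  exists phi => // z; have := phiE z.
  by rewrite /= !clamp_id.
(* Clamping to [-a, a] keeps away from the boundary circles, where the Lagrangian section does not
   exist. *)
have k_csim : csim (fun z => k (z, a)) (fun z => k (z, - a)).
  have cK : continuous (fun y => k (y.1, clamp (- a) a y.2)).
    move=> y; have FY : Filter (nbhs y) := nbhs_filter y.
    have oy y' : open_cylinder R (y'.1, clamp (- a) a y'.2).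
      have /andP[h1 h2] : - a <= clamp (- a) a y'.2 <= a by apply: clamp_itv; lra.
      by rewrite /open_cylinder /=; apply/andP; split; lra.
    apply: (gdiv_cvg FY).
    - by rewrite btau ?gbase_torus_section//; apply/oP/open_closed_cylinder.
    - apply: filterE => y'.
      by rewrite btau ?gbase_torus_section//; apply/oP/open_closed_cylinder.
    - apply: (tau_cvg _ _ FY _ _ _ _ (@clamp_pair_cvg (- a) a y)).
        exact: open_closed_cylinder.
      by apply: filterE => y'; exact: open_closed_cylinder.
    - exact: (cvg_comp _ _ (@clamp_pair_cvg (- a) a y) (torus_section_cvg hP (oy y))).
  have [phi cphi phiE] := homotopic_csim a (- a) cK.
  exists phi => // z; have := phiE z.
  by rewrite /= !clamp_id//; apply/andP; split; lra.
have [phi0 cphi0 kE] := k_csim.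
have colp z t : a <= t <= 1 -> collar (z, t) by left.
have colm z t : -1 <= t <= - a -> collar (z, t) by right.
have am : -1 <= - a by rewrite lerN2 ltW.
have [||phi1 cphi1 l1E] := l_csim a 1 (ltW a1) colp a 1; rewrite ?lexx ?(ltW a1)//.
have [||phi2 cphi2 l2E] := l_csim (-1) (- a) am colm (- a) (-1); rewrite ?lexx ?am//.
(* Each boundary circle is mapped to a single point. *)
have lconst t : `|t| = 1 -> forall z, l (z, t) = l (expi 0, t).
  move=> t1 z; have ct w : closed_cylinder R (w, t).
    by rewrite /closed_cylinder /= -ler_norml t1.
  have Pz : P (z, t) = P (expi 0, t) by apply/(torus_eq hP (ct z) (ct _)); right.
  by rewrite /l Pz.
have l1 z : l (z, 1) = l (expi 0, 1) by apply: lconst; rewrite normr1.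
have l2 z : l (z, -1) = l (expi 0, -1) by apply: lconst; rewrite normrN1.
have [c1 _ c1E] := expi_surj (l (expi 0, 1)).
have [c2 _ c2E] := expi_surj (l (expi 0, -1)).
(* From g = k / l: [phi0] is the logarithm of the quotient of the two [k]s, while [c1 + phi1] and
   [c2 + phi2] are logarithms of [l] at heights [a] and [- a]. *)
exists (fun z => phi0 z - phi1 z + phi2 z + (c2 - c1)).
  move=> z; have FZ : Filter (nbhs z) := nbhs_filter z.
  exact: cvgD (cvgD (cvgB (cphi0 z) (cphi1 z)) (cphi2 z)) (cvg_cst _).
move=> z.
have ka := klg _ (collar_a z) (open_a z); have kma := klg _ (collar_ma z) (open_ma z).
move: (kE z) (l1E z) (l2E z).
rewrite /= ka kma l1 l2 -c1E -c2E -!expiD => E0 E1 E2.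
have -> : g (z, a) = circle_mul (circle_mul (l (z, a)) (g (z, a))) (cinv (l (z, a))).
  by rewrite (cmulC (l _)) cmulK.
rewrite E0 E1 E2 -expiN (cmulC (expi _) (g _)) -!cmulA -!expiD.
by congr (circle_mul _ (expi _)); ring.
Qed.

Lemma trivial_of_maslov : csim (fun z => g (z, a)) (fun z => g (z, - a)) ->
  exists tau : M -> Gamma J, section_over (obar P) tau.
Proof.
have /andP[a0 a1] := ha; move=> [phi cphi gE].
pose mid : set (circle R * R) := [set y | - a <= y.2 <= a].
have mid_open y : mid y -> open_cylinder R y.
  by move=> /andP[h1 h2]; rewrite /open_cylinder /=; apply/andP; split; lra.
(* Inverse of the interpolated [g]: the affine factor is 0 at height [- a] and 1 at height [a],
   where [phi] turns [g (z, - a)] into [g (z, a)]. *)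
pose h y := cinv (circle_mul (g (y.1, - a)) (expi (phi y.1 * ((y.2 + a) / (2 * a))))).
pose T y := if - a <= y.2 <= a then gact (sec y) (h y) else s (P y).
have gact_inv y : collar y -> open_cylinder R y -> gact (sec y) (cinv (g y)) = s (P y).
  by move=> cy oy; rewrite -gact_g// gactM cmulV gact1.
(* On the two circles common to the band and the collars the interpolation equals [g], so both
   formulas give [s]. *)
have T_collar y : collar y -> T y = s (P y).
  rewrite /T; case: ifP => // /andP[h1 h2] cy.
  have : y.2 = a \/ y.2 = - a.
    by case: cy => /andP[h3 h4]; [left | right]; apply/eqP; rewrite eq_le ?h2 ?h3 ?h1 ?h4.
  case: y h1 h2 cy => z t /= h1 h2 cy [te|te]; rewrite te /h /=.
    have -> : (a + a) / (2 * a) = 1 by field; lra.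
    by rewrite mulr1 -gE; exact: gact_inv (collar_a z) (open_a z).
  have -> : (- a + a) / (2 * a) = 0 by rewrite addNr mul0r.
  by rewrite mulr0 cmul1; exact: gact_inv (collar_ma z) (open_ma z).
have cT1 : {within mid, continuous T}.
  apply/subspace_continuousP => y my; rewrite /from_subspace.
  set F := within _ _; have FF : Filter F by exact: within_filter.
  have Fid : y' @[y' --> F] --> y by exact: cvg_within_filter.
  have c1 : y'.1 @[y' --> F] --> y.1 by exact: (cvg_comp _ _ Fid (@fst_cvg _ _ y)).
  have c2 : y'.2 @[y' --> F] --> y.2 by exact: (cvg_comp _ _ Fid (@snd_cvg _ _ y)).
  have TE y' : mid y' -> gact (sec y') (h y') = T y' by rewrite /T => ->.
  have nm : \forall y' \near F, mid y' by exact: withinT.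
  rewrite -(TE _ my); apply: (cvg_near_eq FF (f := fun y' => gact (sec y') (h y'))).
    by apply: (@filterS _ F FF _ _ _ nm) => y' /TE.
  apply: gact_cvg.
    exact: (cvg_comp _ _ Fid (torus_section_cvg hP (mid_open _ my))).
  apply: cinv_cvg; apply: cmul_cvg.
    have cg : continuous (fun z => g (z, - a)).
      exact: g_continuous (open_ma _) collar_ma.
    exact: (cvg_comp _ _ c1 (cg y.1)).
  apply: expi_cvg; apply: cvgM; first exact: (cvg_comp _ _ c1 (cphi _)).
  by apply: cvgM; [apply: cvgD => //; exact: cvg_cst | exact: cvg_cst].
have cT2 : {within collar, continuous T}.
  apply/subspace_continuousP => y my; rewrite /from_subspace.
  set F := within _ _; have FF : Filter F by exact: within_filter.
  have Fid : y' @[y' --> F] --> y by exact: cvg_within_filter.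
  have nm : \forall y' \near F, collar y' by exact: withinT.
  rewrite T_collar//; apply: (cvg_near_eq FF (f := fun y' => s (P y'))).
    by apply: (@filterS _ F FF _ _ _ nm) => y' /T_collar.
  exact: collar_section_cvg.
have cl (b c : R) : closed [set y : circle R * R | b <= y.2 <= c].
  have -> : [set y : circle R * R | b <= y.2 <= c] = snd @^-1` `[b, c]%classic.
    by apply/seteqP; split => y /=; rewrite in_itv.
  apply: closed_comp; last exact: interval_closed.
  by move=> y _; exact: snd_cvg.
have cT : {within closed_cylinder R, continuous T}.
  have -> : closed_cylinder R = mid `|` collar.
    apply/seteqP; split=> y; last first.
      by move=> [/mid_open/open_closed_cylinder|/collar_closed_cylinder].
    move=> /andP[h1 h2]; have [h3|h3] := leP y.2 a; last first.
      by right; left; rewrite h2 ltW.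
    have [h4|h4] := leP (- a) y.2; first by left; rewrite /mid /= h4.
    by right; right; rewrite h1 ltW.
  apply: withinU_continuous => //; first exact: cl.
  have -> : collar = [set y | a <= y.2 <= 1] `|` [set y | -1 <= y.2 <= - a] by [].
  by apply: closedU; exact: cl.
have gbT y : closed_cylinder R y -> gbase (T y) = P y.
  move=> cy; have [my|/negP my] := boolP (- a <= y.2 <= a).
    by rewrite /T my gbase_gact gbase_torus_section//; exact: mid_open.
  have cly : collar y.
    move: cy => /andP[h1 h2]; have [h3|h3] := leP y.2 a; last by left; rewrite h2 ltW.
    have [h4|h4] := leP (- a) y.2; first by case: my; rewrite h3 h4.
    by right; rewrite h1 ltW.
  by rewrite T_collar// gbase_collar.
(* Distinct points with the same image lie on the boundary circles, where [T] is [s] at that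
   image. *)
have T_eq y y' : closed_cylinder R y -> closed_cylinder R y' -> P y = P y' -> T y = T y'.
  move=> cy cy' pe; have [->//|[n1 n2]] := (torus_eq hP cy cy').1 pe.
  have col (b : circle R * R) : `|b.2| = 1 -> collar b.
    move=> b1; have /orP[/eqP be|/eqP be] : (b.2 == 1) || (b.2 == - 1).
        by have := eqr_norml b.2 1; rewrite b1 eqxx ler01 andbT => <-.
      by left; rewrite be lexx ltW.
    by right; rewrite be lexx lerN2 ltW.
  by rewrite !T_collar ?pe//; exact: col.
(* An arbitrary right inverse of [P]; continuity of [T \o r] comes from [torus_descend], not from
   [r]. *)
pose r q := xget (expi 0, 0) [set y | closed_cylinder R y /\ P y = q].
have rP y : closed_cylinder R y -> closed_cylinder R (r (P y)) /\ P (r (P y)) = P y.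
  move=> cy; apply: (@xgetPex _ (expi 0, 0) [set y' | closed_cylinder R y' /\ P y' = P y]).
  by exists y.
have rT y : closed_cylinder R y -> T (r (P y)) = T y.
  by move=> cy; have [cr Pr] := rP _ cy; exact: T_eq.
exists (T \o r); split; first exact: (torus_descend hP cT rT).
by move=> _ [y cy <-] /=; rewrite rT// gbT.
Qed.

Lemma trivial_over_maslov : trivial_over J (obar P) <->
  maslov_index s (fun z => P (z, a)) (tangent_o P) =
  maslov_index s (fun z => P (z, - a)) (tangent_o P).
Proof.
rewrite (maslov_indexE (open_a _)) (maslov_indexE (open_ma _)).
have dc := degree_csim (g_continuous (open_a _) collar_a)
  (g_continuous (open_ma _) collar_ma).
split=> [/trivial_overP[tau stau]|/dc].
  by apply/dc; exact: maslov_of_trivial stau.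
by move=> /trivial_of_maslov ?; apply/trivial_overP.
Qed.

End MaslovTrivialization.

Theorem theorem33 (R : realType) (M : smooth_manifold R (2 + 2))
    (om : symplectic_form M) (J : compatible_structure om)
    (P : circle R * R -> M) (p0 : M)
    (hP : lagrangian_pinched_torus om P) (hp0 : is_pinch_point P p0)
    (B : set M) (hBopen : open B) (hBcontr : contractible R B) (hBp0 : B p0)
    (a : R) (ha : 0 < a < 1)
    (hPB : P @` [set x | a <= x.2 <= 1 \/ -1 <= x.2 <= - a] `<=` B)
    (s : M -> Gamma J) (hs : section_over B s) :
  trivial_over J (obar P) <->
  maslov_index s (fun z => P (z, a)) (tangent_o P) =
  maslov_index s (fun z => P (z, - a)) (tangent_o P).
(* [s p0] serves as the default value of the section along the torus. *)
Proof. exact: (trivial_over_maslov hP ha hPB hs (s p0)). Qed.
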